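(* Let $n\ge 1$ be an integer. Then, with members of $Ex_3(n;P^3_3)$ considered up to isomorphism: - if $n\le 6$, then $ex_3(n;P^3_3)=\binom n3$ and $Ex_3(n;P^3_3)=\{K^3_n\}$; - if $n=7$, then $ex_3(n;P^3_3)=20$ and $Ex_3(n;P^3_3)=\{K^3_6\cup K^3_1\}$; - if $n\ge 8$, then $ex_3(n;P^3_3)=\binom{n-1}{2}$ and $Ex_3(n;P^3_3)=\{S^3_n\}$.
   Context: A 3-graph is a pair $H=(V,E)$ with $V$ a finite set and $E\subseteq\binom V3$ a family of 3-element subsets of $V$ (the edges); $|H|$ denotes the number of edges. Isolated vertices are allowed. For a 3-graph $F$, a 3-graph is $F$-free if it contains no subhypergraph isomorphic to $F$ (not necessarily induced). The Turán number $ex_3(n;F)$ is the maximum number of edges of an $F$-free 3-graph on $n$ vertices, and $Ex_3(n;F)$ is the set of all pairwise non-isomorphic $n$-vertex $F$-free 3-graphs with exactly $ex_3(n;F)$ edges. $P^3_3$ is the linear path of length 3: the 3-graph with three edges $e_1,e_2,e_3$ such that $|e_1\cap e_2|=|e_2\cap e_3|=1$ and $e_1\cap e_3=\emptyset$ (so it has 7 vertices). $K^3_n$ is the complete 3-graph on $n$ vertices, with all $\binom n3$ triples as edges (for $n<3$ it is a set of $n$ isolated vertices). $S^3_n$ is the full star on $n$ vertices: the 3-graph whose edges are all the $\binom{n-1}{2}$ triples containing one fixed vertex. $F\cup H$ denotes the union of vertex-disjoint copies of $F$ and $H$. *)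

(* Defs.v *)
From HB Require Import structures.
From mathcomp Require Import all_boot.

Set Implicit Arguments.
Unset Strict Implicit.
Unset Printing Implicit Defensive.

Record graph3 (V : finType) := Graph3 {
  edges : {set {set V}};
  edges_card3 : [forall e in edges, #|e| == 3]
}.

HB.instance Definition _ (V : finType) := [isSub for @edges V].
HB.instance Definition _ (V : finType) := [Finite of graph3 V by <:].

(* A copy of F in H is the image of an injective vertex map sending edges to
   edges; the copy need not be induced. *)
Definition contains (U V : finType) (F : graph3 U) (H : graph3 V) : bool :=
  [exists f : {ffun U -> V},
     injectiveb f && [forall e in edges F, f @: e \in edges H]].

Definition free (U V : finType) (F : graph3 U) (H : graph3 V) : bool :=
  ~~ contains F H.

Definition isomorphic (V W : finType) (G : graph3 V) (H : graph3 W) : Prop :=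
  exists2 f : V -> W, bijective f &
    edges H = [set f @: (e : {set V}) | e in edges G].

(* The maximum over an empty family is 0; this only matters when F has no
   edges, since otherwise the edgeless graph is F-free. *)
Definition ex3 (U : finType) (n : nat) (F : graph3 U) : nat :=
  \max_(H : graph3 'I_n | free F H) #|edges H|.

(* Membership in Ex_3(n; F), for a graph on any vertex type with n elements. *)
Definition in_Ex3 (U V : finType) (n : nat) (F : graph3 U) (H : graph3 V) :
    Prop :=
  [/\ #|V| = n, free F H & #|edges H| = ex3 n F].

(* Ex_3(n; F) = {K}, the members of Ex_3(n; F) being taken up to isomorphism. *)
Definition Ex3_unique (U W : finType) (n : nat) (F : graph3 U) (K : graph3 W) :
    Prop :=
  in_Ex3 n F K /\
  forall (V : finType) (H : graph3 V), in_Ex3 n F H -> isomorphic H K.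

Fact complete_card3 (V : finType) :
  [forall e in [set e : {set V} | #|e| == 3], #|e| == 3].
Proof. by apply/forall_inP=> e; rewrite inE. Qed.

Definition complete3 (n : nat) : graph3 'I_n :=
  Graph3 (@complete_card3 'I_n).

Fact star_card3 (V : finType) (c : V) :
  [forall e in [set e : {set V} | (#|e| == 3) && (c \in e)], #|e| == 3].
Proof. by apply/forall_inP=> e; rewrite inE => /andP[]. Qed.

(* A full star needs a centre, hence the hypothesis; the centre is vertex 0. *)
Definition star3 (n : nat) (n_gt0 : 0 < n) : graph3 'I_n :=
  Graph3 (star_card3 (Ordinal n_gt0)).

Section DisjointUnion.
Variables (V W : finType) (G : graph3 V) (H : graph3 W).

Definition dunion_edges : {set {set (V + W)%type}} :=
  [set [set inl x | x in e] | e : {set V} in edges G] :|: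
  [set [set inr y | y in e] | e : {set W} in edges H].

Fact dunion_card3 : [forall e in dunion_edges, #|e| == 3].
Proof.
apply/forall_inP=> e; rewrite inE => /orP[] /imsetP[d dE ->].
  rewrite card_imset; first exact: (forall_inP (edges_card3 G)).
  by move=> x y [].
rewrite card_imset; first exact: (forall_inP (edges_card3 H)).
by move=> x y [].
Qed.

Definition dunion : graph3 (V + W)%type := Graph3 dunion_card3.

End DisjointUnion.

(* The three edges are {0, 1, 2}, {2, 3, 4} and {4, 5, 6}. *)
Definition path_edge (i : 'I_3) : {set 'I_7} :=
  [set x : 'I_7 | i.*2 <= x <= i.*2 + 2].

Fact path_card3 : [forall e in [set path_edge i | i : 'I_3], #|e| == 3].
Proof.
apply/forall_inP=> e /imsetP[i _ ->]; rewrite cardsE -sum1_card big_mkcond /=.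
by case: i => [[|[|[|//]]] lti]; rewrite !big_ord_recl big_ord0.
Qed.

Definition P33 : graph3 'I_7 := Graph3 path_card3.

Fact path_edge_meet (i j : 'I_3) :
  #|path_edge i :&: path_edge j| =
  if i == j then 3 else if (j == i.+1 :> nat) || (i == j.+1 :> nat) then 1 else 0.
Proof.
rewrite -sum1_card big_mkcond /=.
by case: i => [[|[|[|//]]] lti]; case: j => [[|[|[|//]]] ltj];
  rewrite !big_ord_recl big_ord0 !inE.
Qed.

(* Main.v *)
Require Import Defs.
From mathcomp Require Import all_boot zify.

(** Three edges e, f, g form a copy of P33 exactly when e and f share one
    vertex, f and g share one vertex, and e and g are disjoint
    ([free_path_free]), so the question is about families of triples of a
    finite set S that avoid this pattern ([path_free]).  With n = #|S|, the
    heart of the proof is [path_free_extremal]: for n > 6 a path-free family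
    has fewer than [bound n] edges, or n = 7 and all edges lie in six
    vertices, or n > 7 and all edges share a vertex.  It goes by strong
    induction on n, in two cases according to the presence of a triangle,
    that is, of three edges that meet pairwise in one vertex and have no
    common vertex.

    Suppose first that there is no triangle.  If every degree is at most
    n - 1, then the number of edges is at most n(n - 1)/3, which is less than
    the bound.  Otherwise fix v of degree at least n.  If every edge contains
    v, the family is a star.  If an edge e at v meets an edge h that avoids v
    in exactly one vertex, then path-freeness and triangle-freeness force
    every edge f at v with [e :&: f = [set v]] to meet h in two vertices
    ([crossing_meet]).  Almost all edges at v then contain a second common
    vertex s, and counting leaves h as the only edge that avoids v, so there
    are at most n + 2 edges ([crossing_star], [crossing_small]).  If no such
    pair e, h exists, the edges at v separate into those whose other two vertices
    lie in the union B of the edges avoiding v and those disjoint from B; the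
    family is the union of two families that share only the vertex v, one of
    them a star, and the induction hypothesis for the other one suffices
    ([noncrossing_small]).

    Suppose now that there is a triangle, and let U be the set of its six
    vertices.  An edge that meets U without lying in U meets it in one of six
    pairs ([trace_pair]); these six pairs fall into three couples of disjoint
    pairs, and an edge on one pair of a couple and an edge on the other must
    share their vertex outside U ([attached_card]).  So if k > 0 vertices
    outside U are joined to U, there are at most 3 max(k, 2) such edges, at
    most 13 edges inside U ([attached_inner]), and the remaining edges avoid
    all these vertices.  If k = 0, then U carries at most 20 edges and is
    separate from the rest.  In both situations the induction hypothesis
    applies to the rest, and only n = 7, k = 0 reaches the bound. *)

Set Implicit Arguments.
Unset Strict Implicit.
Unset Printing Implicit Defensive.

(** * The extremal numbers *)

(** The value 20 at 7 comes from a complete 3-graph on six vertices, which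
    there still beats the star with its 15 edges. *)
Definition bound n := if n <= 6 then 'C(n, 3) else if n == 7 then 20 else 'C(n.-1, 2).

Lemma bin2_mul n : 'C(n, 2) * 2 = n * n.-1.
Proof. by have := bin_ffact n 2; rewrite ffactnS ffactn1. Qed.

Lemma bin2D a b : 'C(a + b, 2) = 'C(a, 2) + 'C(b, 2) + a * b.
Proof.
have := bin2_mul a; have := bin2_mul b; have := bin2_mul (a + b).
by case: a b => [|a] [|b] //=; nia.
Qed.

(** A family that splits at a vertex into a star on a further vertices and a
    part on b further vertices is below the bound.  This fails for small a:
    with b = 5 and a = 2, a complete 3-graph on six vertices and one further
    edge reach the bound for eight vertices. *)
Lemma bound_star a b : 3 < a -> 2 < b -> 'C(a, 2) + bound b.+1 < bound (a + b).+1.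
Proof.
move=> a4 b3; rewrite [X in _ < X]/bound ifN; last by rewrite -ltnNge; lia.
rewrite ifN /=; last by apply/eqP; lia.
rewrite bin2D -addnA ltn_add2l.
apply: leq_trans (_ : 'C(b, 2) + 4 * b <= _); last by rewrite leq_add2l leq_mul2r a4 orbT.
case: b b3 => [|[|[|[|[|[|[|b]]]]]]] // _.
rewrite /bound /= -addn1 leq_add2l; lia.
Qed.

Lemma bound_bin n : 6 < n -> 'C(n.-1, 2) <= bound n.
Proof.
move=> n7; rewrite /bound ifN; last by rewrite -ltnNge.
by case: eqP => [->|].
Qed.

Lemma bound_le m : bound m <= 'C(m, 2) + 5.
Proof.
case: m => [|[|[|[|[|[|[|[|m]]]]]]]] //; rewrite /bound /=.
by apply: leq_trans (leq_addr _ _); apply: leq_bin2l.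
Qed.

(** For m = 1 there is equality, which is the extremal case on seven
    vertices. *)
Lemma bound_block m : 1 < m -> 20 + bound m < bound (m + 6).
Proof.
move=> m2; have [m4|m4] := ltnP 3 m; last by case: m m2 m4 => [|[|[|[|m]]]].
have -> : bound (m + 6) = 'C(m + 5, 2).
  rewrite /bound ifN ?ifN; first by rewrite addnS.
    by apply/eqP; lia.
  by rewrite -ltnNge; lia.
have := bound_le m; rewrite bin2D (_ : 'C(5, 2) = 10) //; lia.
Qed.

(** The left-hand side counts a six-vertex set with at most 13 edges inside,
    its at most 3 max(k, 2) edges towards k outside vertices, and m further
    vertices. *)
Lemma bound_attached m k :
  0 < k -> 13 + 3 * maxn k 2 + bound m < bound (m + 6 + k).
Proof.
move=> k0; have := bound_le m.
have [|big] := leqP (m + k) 2.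
  by case: m k k0 => [|[|m]] [|[|[|k]]] //; rewrite ?addSn ?addnS.
have -> : bound (m + 6 + k) = 'C(m + (5 + k), 2).
  rewrite /bound ifN ?ifN; first by congr 'C(_, 2); lia.
    by apply/eqP; lia.
  by rewrite -ltnNge; lia.
rewrite !bin2D (_ : 'C(5, 2) = 10) //; have := bin2_mul k.
by case: (leqP k 2) => k2; nia.
Qed.

(** * Families of triples *)

Section Triples.
Variable T : finType.
Implicit Types (A B S U e f g h : {set T}) (E F K : {set {set T}}) (v s x y : T).

Definition triples S : {set {set T}} := [set e : {set T} | e \subset S & #|e| == 3].

Lemma card_triples S : #|triples S| = 'C(#|S|, 3).
Proof. exact: cards_draws. Qed.

Lemma triples_sub E S e : E \subset triples S -> e \in E -> e \subset S.
Proof. by move=> /subsetP/[apply]; rewrite inE => /andP[]. Qed.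

Lemma triples_card E S e : E \subset triples S -> e \in E -> #|e| = 3.
Proof. by move=> /subsetP/[apply]; rewrite inE => /andP[_ /eqP]. Qed.

Lemma card_setI_seq g (s : seq T) :
  uniq s -> #|g :&: [set x in s]| = count [in g] s.
Proof.
move=> us; rewrite -size_filter -(card_uniqP (filter_uniq _ us)).
by apply: eq_card => x; rewrite !inE mem_filter.
Qed.

Lemma triple_eq e x y z :
  #|e| = 3 -> uniq [:: x; y; z] -> [&& x \in e, y \in e & z \in e] ->
  e = [set t in [:: x; y; z]].
Proof.
move=> e3 u /and3P[xe ye ze]; apply/esym/eqP; rewrite eqEcard cardsE.
rewrite (card_uniqP u) e3 leqnn andbT; apply/subsetP => t.
by rewrite !inE => /or3P[] /eqP->.
Qed.

Lemma third_vertex e x y :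
  #|e| = 3 -> x != y -> x \in e -> y \in e ->
  exists2 z, uniq [:: x; y; z] & e = [set t in [:: x; y; z]].
Proof.
move=> e3 xy xe ye; have yx : y != x by rewrite eq_sym.
have /card_gt0P[z] : 0 < #|e :\ x :\ y|.
  by move: e3; rewrite (cardsD1 x) xe (cardsD1 y) !inE yx ye; case: #|_|.
rewrite !inE => /and3P[zy zx ze].
have u : uniq [:: x; y; z] by rewrite /= !inE negb_or xy eq_sym zx eq_sym zy.
by exists z => //; apply: triple_eq => //; rewrite xe ye.
Qed.

(** Double counting of incidences; with S the whole vertex set it is the
    handshake lemma, and applied to the edges at a vertex it counts
    codegrees. *)
Lemma handshake F S :
  \sum_(x in S) #|[set e in F | x \in e]| = \sum_(e in F) #|e :&: S|.
Proof.
transitivity (\sum_(x in S) \sum_(e in F) (x \in e : nat)).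
  apply: eq_bigr => x _; rewrite -sum1_card -big_mkcondr /=.
  by apply: eq_bigl => e; rewrite inE.
rewrite exchange_big /=; apply: eq_bigr => e _.
rewrite -sum1_card -big_mkcondr /=; apply: eq_bigl => x; rewrite inE andbC //.
Qed.

(** Removing v maps the edges injectively to pairs of the other vertices. *)
Lemma star_card F S v :
  F \subset triples S -> (forall e, e \in F -> v \in e) -> #|F| <= 'C(#|S|.-1, 2).
Proof.
move=> FS Fv; have [->|[e0 e0F]] := set_0Vmem F; first by rewrite cards0.
have vS : v \in S := subsetP (triples_sub FS e0F) v (Fv _ e0F).
have -> : #|S|.-1 = #|S :\ v| by rewrite (cardsD1 v S) vS.
rewrite -cards_draws -(card_in_imset (f := fun e => e :\ v) (D := mem F)).
  apply: subset_leq_card; apply/subsetP => _ /imsetP[e eF ->].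
  rewrite inE setSD ?(triples_sub FS eF) //=.
  by have := triples_card FS eF; rewrite (cardsD1 v e) (Fv _ eF); lia.
move=> e f eF fF eq_ef; rewrite -(setD1K (Fv _ eF)) -(setD1K (Fv _ fF)).
by congr (_ |: _).
Qed.

(** An edge on a given pair is determined by its third vertex. *)
Lemma codegree_card F S v s :
  F \subset triples S -> v != s -> (forall e, e \in F -> (v \in e) && (s \in e)) ->
  #|F| <= #|S| - 2.
Proof.
move=> FS vs Fvs; have [->|[e0 e0F]] := set_0Vmem F; first by rewrite cards0.
have /andP[ve0 se0] := Fvs _ e0F.
have vS : v \in S := subsetP (triples_sub FS e0F) v ve0.
have sS : s \in S := subsetP (triples_sub FS e0F) s se0.
have -> : #|S| - 2 = #|S :\ v :\ s|.
  by rewrite (cardsD1 v S) vS (cardsD1 s (S :\ v)) !inE eq_sym vs sS; lia.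
apply: leq_trans (leq_imset_card (fun z => [set t in [:: v; s; z]]) _).
apply: subset_leq_card; apply/subsetP => e eF.
have /andP[ve se] := Fvs _ eF; have e3 := triples_card FS eF.
have [z u ez] := third_vertex e3 vs ve se; apply/imsetP; exists z => //.
move: u; rewrite /= !inE negb_or andbT => /andP[/andP[_ vz] sz].
rewrite eq_sym sz eq_sym vz (subsetP (triples_sub FS eF)) //.
by rewrite ez !inE eqxx !orbT.
Qed.

(** In the link of v this says that more than three pairwise intersecting
    graph edges form a star: the only other maximal intersecting graph is the
    triangle. *)
Lemma intersecting_star F v :
  (forall e, e \in F -> #|e| = 3 /\ v \in e) ->
  (forall e f, e \in F -> f \in F -> 1 < #|e :&: f|) ->
  3 < #|F| -> exists2 s, s != v & forall e, e \in F -> s \in e.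
Proof.
move=> F3 Fint F4.
have /card_gt1P[e [f [eF fF ef]]] : 1 < #|F| by lia.
have [e3 ve] := F3 _ eF; have [f3 vf] := F3 _ fF.
have ef2 : #|e :&: f| = 2.
  apply/eqP; rewrite eqn_leq Fint // andbT leqNgt; apply/negP => ef3.
  case/eqP: ef; apply/eqP; rewrite eqEcard e3 f3 leqnn andbT.
  apply/setIidPl/eqP; by rewrite eqEcard subsetIl e3.
have /card_gt0P[s] : 0 < #|(e :&: f) :\ v|.
  by move: ef2; rewrite (cardsD1 v) inE ve vf; lia.
rewrite !inE => /and3P[sv se sf]; exists s => // g0 g0F; apply/negPn/negP => sg.
have vs : v != s by rewrite eq_sym.
have [a ua ea] := third_vertex e3 vs ve se.
have [b ub fb] := third_vertex f3 vs vf sf.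
have ab : a != b by apply: contraNneq ef => ab; rewrite ea fb ab.
have uab : uniq [:: v; a; b].
  move: ua ub ab; rewrite /= !inE !negb_or !andbT => /andP[/andP[_ ->] _].
  by case/andP => /andP[_ ->] _ ->.
have cnt k : k \in F -> [/\ 0 < (s \in k) + (a \in k), 0 < (s \in k) + (b \in k) &
    #|k| = 3 /\ v \in k].
  move=> kF; have [k3 vk] := F3 _ kF.
  have := Fint _ _ kF eF; have := Fint _ _ kF fF.
  by rewrite ea fb !card_setI_seq //= vk !addn0.
have g_ab k : k \in F -> s \notin k -> k = [set t in [:: v; a; b]].
  move=> kF sk; have [] := cnt _ kF; rewrite (negPf sk) !add0n !lt0b => ak bk [k3 vk].
  by apply: triple_eq; rewrite ?vk ?ak.
suff /subsetP/subset_leq_card : {subset F <= [:: e; f; g0]}.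
  by move/leq_trans/(_ (card_size _)); rewrite leqNgt F4.
move=> k kF; rewrite !inE; have [sk|sk] := boolP (s \in k); last first.
  by rewrite (g_ab _ kF sk) (g_ab _ g0F sg) eqxx !orbT.
have [_ _ [k3 vk]] := cnt _ kF.
have : (a \in k) || (b \in k).
  have := Fint _ _ kF g0F; rewrite (g_ab _ g0F sg) card_setI_seq //= vk.
  by case: (a \in k); case: (b \in k).
case/orP => [ak|bk].
  by rewrite (triple_eq k3 ua) -?ea ?eqxx // vk sk.
by rewrite (triple_eq k3 ub) -?fb ?eqxx ?orbT // vk sk.
Qed.

(** * Paths, triangles and crossing edges *)

Definition path_free E := forall e f g, e \in E -> f \in E -> g \in E ->
  #|e :&: f| = 1 -> #|f :&: g| = 1 -> 0 < #|e :&: g|.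

Definition triangle e f g :=
  [/\ #|e :&: f| = 1, #|f :&: g| = 1, #|e :&: g| = 1 & e :&: f :&: g = set0].

Definition triangle_free E := forall e f g, e \in E -> f \in E -> g \in E ->
  ~ triangle e f g.

Definition through E v : {set {set T}} := [set e in E | v \in e].

(** An edge at v with two vertices in h, v not in h, has no room for another
    vertex. *)
Lemma sub_throughU1 E S v h e :
  E \subset triples S -> e \in through E v -> v \notin h -> 1 < #|e :&: h| ->
  e \subset v |: h.
Proof.
move=> ES; rewrite inE => /andP[eE ve] vh eh.
suff /eqP <- : e :&: (v |: h) == e by rewrite subsetIr.
rewrite eqEcard subsetIl (triples_card ES eE) setIUr cardsU.
have -> : e :&: [set v] :&: (e :&: h) = set0.
  by apply/setP => x; rewrite !inE; case: eqP => [->|_]; rewrite ?(negPf vh) !andbF.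
have -> : e :&: [set v] = [set v] by apply/setIidPr; rewrite sub1set.
by rewrite cards1 cards0; lia.
Qed.

(** If e and f share only v, then disjointness of f and h yields the path
    h, e, f, and a single common vertex of f and h yields the triangle
    e, f, h. *)
Lemma crossing_meet E S v h e f :
  E \subset triples S -> path_free E -> triangle_free E ->
  h \in E -> v \notin h -> e \in through E v -> f \in through E v ->
  #|e :&: h| = 1 -> #|f :&: h| <= 1 -> 1 < #|e :&: f|.
Proof.
move=> ES Pf Tf hE vh; rewrite !inE => /andP[eE ve] /andP[fE vf] eh fh.
have ef0 : 0 < #|e :&: f| by apply/card_gt0P; exists v; rewrite inE ve.
rewrite ltnNge; apply/negP => ef; have {ef0}ef : #|e :&: f| = 1 by lia.
have hf : 0 < #|h :&: f| by apply: (Pf h e f); rewrite // setIC.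
apply: (Tf e f h) => //; split=> //; first by move: hf; rewrite setIC; lia.
have /eqP/cards1P[x efx] := ef.
have : v \in e :&: f by rewrite inE ve.
rewrite efx inE => /eqP <-; apply/setP => y; rewrite !inE.
by case: eqP => // ->; apply/negbTE.
Qed.

(** Among the edges at v, let M consist of those that meet h in at most one
    vertex.  They pairwise share a vertex other than v, by [crossing_meet]
    when one of the two meets h, and otherwise because both contain the
    vertex of e outside v and h.  At most three edges at v lie outside M, so
    M is large enough to be a star in the link of v.  Its centre s cannot be in
    h, as then at most n - 1 edges would contain v. *)
Lemma crossing_star E S v h e :
  E \subset triples S -> path_free E -> triangle_free E ->
  6 < #|S| <= #|through E v| -> h \in E -> v \notin h ->
  e \in through E v -> #|e :&: h| = 1 ->
  exists s, [/\ s != v, s \notin h &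
    forall f, f \in through E v -> s \in f \/ f \subset v |: h].
Proof.
move=> ES Pf Tf /andP[S7 dv] hE vh ev eh.
pose M := [set f in through E v | #|f :&: h| <= 1].
have evE : through E v \subset triples S.
  by apply: subset_trans ES; apply/subsetP => f; rewrite inE => /andP[].
have inner f : f \in through E v -> f \notin M -> f \subset v |: h.
  move=> fv; rewrite inE fv -ltnNge; exact: (sub_throughU1 ES).
have h3 := triples_card ES hE.
have cvh : #|v |: h| = 4 by rewrite cardsU1 vh h3.
(* Used with A = v |: h to bound the edges outside M, and with A = v |: (h :\ s)
   when s would be in h. *)
have innerC (F : {set {set T}}) (A : {set T}) : F \subset through E v -> #|A| <= 4 ->
    (forall f : {set T}, f \in F -> f \subset A) -> #|F| <= 'C(#|A|.-1, 2).
  move=> Fv A4 FA; apply: (@star_card F A v) => [|f /(subsetP Fv)]; last first.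
    by rewrite inE => /andP[].
  apply/subsetP => f fF; rewrite inE FA //=; apply/eqP.
  exact: (triples_card evE (subsetP Fv _ fF)).
have M4 : 3 < #|M|.
  have := cardsID M (through E v); rewrite (setIidPr _); last first.
    by apply/subsetP => f; rewrite inE => /andP[].
  suff : #|through E v :\: M| <= 3 by lia.
  have := innerC (through E v :\: M) (v |: h); rewrite cvh; apply => //.
    exact: subsetDl.
  by move=> f; rewrite inE => /andP[fM fv]; apply: inner.
have [s sv Ms] : exists2 s, s != v & forall f, f \in M -> s \in f.
  apply: (@intersecting_star M v) => //.
    move=> f; rewrite !inE => /andP[/andP[fE vf] _]; split=> //.
    exact: triples_card ES fE.
  move=> f g; rewrite [f \in M]inE [g \in M]inE => /andP[fv fh] /andP[gv gh].
  have [fh1|fh1] := eqVneq #|f :&: h| 1; first exact: (crossing_meet ES Pf Tf hE vh).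
  have [gh1|gh1] := eqVneq #|g :&: h| 1.
    by rewrite setIC; apply: (crossing_meet ES Pf Tf hE vh).
  have ef := crossing_meet ES Pf Tf hE vh ev fv eh fh.
  have eg := crossing_meet ES Pf Tf hE vh ev gv eh gh.
  have {}fh : f :&: h = set0 by apply/eqP; rewrite -cards_eq0; lia.
  have {}gh : g :&: h = set0 by apply/eqP; rewrite -cards_eq0; lia.
  (* Neither f nor g meets h: both then contain e minus h, that is v and one
     more vertex. *)
  have eDh : #|e :\: h| = 2.
    have := cardsID h e; rewrite eh; move: ev; rewrite inE => /andP[eE _].
    by rewrite (triples_card ES eE); lia.
  have key k : k :&: h = set0 -> 1 < #|e :&: k| -> e :\: h \subset k.
    move=> kh ek; suff /eqP <- : (e :\: h) :&: k == e :\: h by rewrite subsetIr.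
    rewrite eqEcard subsetIl eDh; apply: leq_trans ek _.
    apply/subset_leq_card/subsetP => x; rewrite !inE => /andP[xe xk].
    rewrite xe xk !andbT; apply: contraTN xk => xh; apply/negP => xk.
    by have := in_set0 x; rewrite -kh inE xk xh.
  rewrite -eDh; apply: subset_leq_card; rewrite subsetI; apply/andP.
  by split; apply: key.
exists s; split=> //; last first.
  by move=> f fv; have [/Ms|/(inner _ fv)] := boolP (f \in M); [left|right].
apply/negP => sh.
have c1 : #|[set f in through E v | s \in f]| <= #|S| - 2.
  apply: (@codegree_card _ S v s); rewrite 1?eq_sym //.
    by apply: subset_trans evE; apply/subsetP => f; rewrite inE => /andP[].
  by move=> f; rewrite !inE => /andP[/andP[_ ->]].
have c2 : #|[set f in through E v | s \notin f]| <= 1.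
  have hs : #|h :\ s| = 2 by move: h3; rewrite (cardsD1 s) sh; lia.
  have vhs : #|v |: h :\ s| = 3 by rewrite cardsU1 !inE (negPf vh) andbF hs.
  have := innerC [set f in through E v | s \notin f] (v |: h :\ s).
  rewrite vhs; apply => //; first by apply/subsetP => f; rewrite inE => /andP[].
  move=> f; rewrite inE => /andP[fv sf].
  have : f \subset v |: h by apply: inner => //; apply: contra sf; apply: Ms.
  move/subsetP=> fsub; apply/subsetP => x xf; have := fsub x xf.
  rewrite !inE; case: eqP => //= _ ->; rewrite andbT.
  by apply: contraNneq sf => <-.
have : through E v = [set f in through E v | s \in f] :|: [set f in through E v | s \notin f].
  by apply/setP => f; rewrite !inE; case: (s \in f); rewrite !(andbT, andbF, orbF).
move/(congr1 (fun F : {set _} => #|F|)); rewrite cardsU; lia.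
Qed.

(** Let K be the edges on the pair v, s given by [crossing_star] and I the
    other edges at v; I has at least two elements, all inside [v |: h].  The
    size of K forces every edge g avoiding v to be crossed by an edge at v,
    and then to have the same s, so that I also lies inside [v |: g].  Two
    elements of I already cover h, hence g = h. *)
Lemma crossing_small E S v h e :
  E \subset triples S -> path_free E -> triangle_free E ->
  6 < #|S| <= #|through E v| -> h \in E -> v \notin h ->
  e \in through E v -> #|e :&: h| = 1 -> #|E| <= #|S| + 2.
Proof.
move=> ES Pf Tf dv hE vh ev eh.
have [s [sv sh star]] := crossing_star ES Pf Tf dv hE vh ev eh.
case/andP: (dv) => S7 dvS.
pose K := [set f in through E v | s \in f].
pose I := [set f in through E v | s \notin f].
have KI : #|K| + #|I| = #|through E v|.
  have -> : K = through E v :&: [set f : {set T} | s \in f].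
    by apply/setP => f; rewrite !inE.
  have -> : I = through E v :\: [set f : {set T} | s \in f].
    by apply/setP => f; rewrite !inE andbC.
  exact: cardsID.
have evE : through E v \subset triples S.
  by apply: subset_trans ES; apply/subsetP => f; rewrite inE => /andP[].
have KA (F : {set {set T}}) (A : {set T}) :
    F \subset K -> (forall f : {set T}, f \in F -> f \subset A) ->
    #|F| <= #|A| - 2.
  move=> FK FA; apply: (@codegree_card F A v s); rewrite 1?eq_sym //; last first.
    by move=> f /(subsetP FK); rewrite !inE => /andP[/andP[_ ->]].
  apply/subsetP => f fF; rewrite inE FA //=; apply/eqP.
  by move/(subsetP FK): fF; rewrite inE => /andP[/(triples_card evE)].
have IA (A : {set T}) : (forall f : {set T}, f \in I -> f \subset A) -> #|I| <= 'C(#|A|.-1, 2).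
  move=> FA; apply: (@star_card I A v); last by move=> f; rewrite !inE => /andP[/andP[]].
  apply/subsetP => f fF; rewrite inE FA //=; apply/eqP.
  by move: fF; rewrite inE => /andP[/(triples_card evE)].
have KS : #|K| <= #|S| - 2.
  by apply: KA => // f; rewrite inE => /andP[/(triples_sub evE)].
have Ih (f : {set T}) : f \in I -> f \subset v |: h.
  by rewrite inE => /andP[/star[->|]].
have c4 (g : {set T}) : g \in E -> v \notin g -> #|v |: g| = 4.
  by move=> gE vg; rewrite cardsU1 vg (triples_card ES gE).
have I3 : #|I| <= 3 by have := IA _ Ih; rewrite c4.
have [K4 KS5 I2] : [/\ 3 < #|K|, #|S| - 5 < #|K| & 1 < #|I|].
  by move: KI KS I3 S7 dvS; clear; split; lia.
have cross (g : {set T}) : g \in E -> v \notin g ->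
    exists2 f : {set T}, f \in through E v & #|f :&: g| = 1.
  move=> gE vg.
  suff /exists_inP[f fv /eqP fg] : [exists f in through E v, #|f :&: g| == 1].
    by exists f.
  apply: contraT; rewrite negb_exists_in.
  move=> /forall_inP ncross; have g3 := triples_card ES gE.
  have [sg|sg] := boolP (s \in g).
    suff : #|K| <= #|v |: g| - 2 by rewrite c4 // leqNgt (ltn_trans _ K4).
    apply: KA => // f; rewrite inE => /andP[fv sf].
    apply: (sub_throughU1 ES) => //.
    rewrite ltn_neqAle eq_sym ncross //=; apply/card_gt0P; exists s.
    by rewrite inE sf.
  suff : #|K| <= #|S :\: g| - 2.
    by rewrite cardsD (setIidPr (triples_sub ES gE)) g3 -subnDA leqNgt KS5.
  apply: KA => // f; rewrite inE => /andP[fv sf].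
  rewrite subsetD (triples_sub evE fv) -setI_eq0 -cards_eq0 /=.
  apply: contraT => fg0; have fg1 := ncross _ fv.
  have : f \subset v |: g.
    apply: (sub_throughU1 ES) => //.
    by move: fg0 fg1; case: #|_| => [|[|]].
  by move/subsetP/(_ s sf); rewrite !inE (negPf sv) (negPf sg).
have uniq_h (g : {set T}) : g \in E -> v \notin g -> g = h.
  move=> gE vg; have [f fv fg] := cross g gE vg.
  have [s' [s'v s'g star']] := crossing_star ES Pf Tf dv gE vg fv fg.
  have ss' : s = s'.
    apply/eqP; apply: contraT => ss'.
    suff : #|K| <= 3 by rewrite leqNgt K4.
    have -> : K = [set k in K | s' \in k] :|: [set k in K | s' \notin k].
      by apply/setP => k; rewrite !inE; case: (s' \in k); rewrite !(andbT, andbF, orbF).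
    apply: leq_trans (_ : 1 + 2 <= _) => //.
    apply: leq_trans (leq_card_setU _ _) (leq_add _ _).
      (* An edge on v, s and s' is the triple v s s' itself; the others lie in
       v |: g by the choice of s'. *)
    have -> : 1 = #|[set x in [:: v; s; s']]| - 2.
        rewrite cardsE (card_uniqP _) //= !inE negb_or [v == s]eq_sym sv.
        by rewrite [v == s']eq_sym s'v ss'.
      apply: KA => [|k]; first by apply/subsetP => k; rewrite inE => /andP[].
      rewrite !inE => /andP[/andP[/andP[kE vk] sk] s'k].
      rewrite -(@triple_eq k v s s') //=; first exact: triples_card ES kE.
        by rewrite !inE negb_or [v == s]eq_sym sv [v == s']eq_sym s'v ss'.
      by rewrite vk sk s'k.
    rewrite -[2]/(4 - 2) -(c4 g gE vg); apply: KA => [|k].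
      by apply/subsetP => k; rewrite inE => /andP[].
    rewrite !inE => /andP[/andP[/andP[kE vk] sk] s'k].
    by have [||//] := star' k; rewrite ?inE ?kE ?(negPf s'k).
  have {star'}Ig (k : {set T}) : k \in I -> k \subset v |: g.
    by rewrite inE ss' => /andP[/star'[->|]].
  have : #|I| <= 'C(#|v |: (h :&: g)|.-1, 2).
    by apply: IA => k kI; rewrite setUIr subsetI Ih // Ig.
  have h3 := triples_card ES hE; have g3 := triples_card ES gE.
  rewrite cardsU1 inE (negPf vh) /= => IC.
  have hg : 2 < #|h :&: g|.
    rewrite ltnNge; apply/negP => hg2.
    have : 'C(#|h :&: g|, 2) <= 'C(2, 2) by apply: leq_bin2l.
    by rewrite binn leqNgt (leq_trans I2).
  have hgh : h :&: g = h by apply/eqP; rewrite eqEcard subsetIl h3.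
  by apply/eqP; rewrite eq_sym eqEcard g3 h3 leqnn andbT; apply/setIidPl.
have EU : E \subset h |: through E v.
  apply/subsetP => g gE; rewrite in_setU1 inE gE /=.
  by have [//|vg] := boolP (v \in g); rewrite ?orbT // (uniq_h g) ?eqxx.
have := subset_leq_card EU; rewrite cardsU1 -KI.
by move: KS I3 S7; case: (_ \notin _); clear; lia.
Qed.

(** * Triangle-free families *)

(** The form in which the induction hypothesis on the number of vertices is
    passed to the lemmas that bound a part of the family. *)
Definition bounded_below n := forall S E,
  #|S| < n -> E \subset triples S -> path_free E -> #|E| <= bound #|S|.

Lemma path_free_sub E F : F \subset E -> path_free E -> path_free F.
Proof. by move=> /subsetP FE Pf e f g /FE eE /FE fE /FE gE; apply: Pf. Qed.

(** Let B be the union of the edges avoiding v and A the set of the other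
    vertices different from v.  An edge at v that reaches an edge h avoiding
    v has its other two vertices in h, so no edge at v meets both A and B.
    Since v has degree at least n, some pair on v has codegree at least 3;
    such a pair lies on the side of A, which therefore has at least four
    vertices, and [bound_star] applies. *)
Lemma noncrossing_small E S v h :
  bounded_below #|S| -> E \subset triples S -> path_free E ->
  6 < #|S| <= #|through E v| -> h \in E -> v \notin h ->
  (forall g e, g \in E -> v \notin g -> e \in through E v -> #|e :&: g| != 1) ->
  #|E| < bound #|S|.
Proof.
move=> IH ES Pf /andP[S7 dv] hE vh ncross.
have evE : through E v \subset triples S.
  by apply: subset_trans ES; apply/subsetP => f; rewrite inE => /andP[].
have vS : v \in S.
  have /card_gt0P[e ev] : 0 < #|through E v| by lia.
  by apply: (subsetP (triples_sub evE ev)); move: ev; rewrite inE => /andP[].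
pose B := \bigcup_(g in E | v \notin g) g.
pose A := S :\ v :\: B.
have BP x : x \in B -> exists g, [/\ g \in E, v \notin g & x \in g].
  by case/bigcupP => g /andP[gE vg] xg; exists g.
have gB g : g \in E -> v \notin g -> g \subset B.
  by move=> gE vg; apply: (bigcup_sup g); rewrite gE.
have vB : v \notin B by apply/negP => /BP[g [_ /negP]].
have BS : B \subset S :\ v.
  apply/subsetP => x /BP[g [gE vg xg]].
  rewrite !inE (subsetP (triples_sub ES gE)) // andbT.
  by apply: contraNneq vg => <-.
have Scard : #|S| = (#|A| + #|B|).+1.
  by rewrite (cardsD1 v S) vS -(cardsID B (S :\ v)) (setIidPr BS) [#|A| + _]addnC.
have meet e g x : e \in through E v -> g \in E -> v \notin g -> x \in e -> x \in g ->
    e \subset v |: g.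
  move=> ev gE vg xe xg; apply: (sub_throughU1 ES) => //.
  rewrite ltn_neqAle eq_sym ncross //; apply/card_gt0P; exists x.
  by rewrite inE xe.
have sides e : e \in through E v -> e \subset v |: A \/ e \subset v |: B.
  move=> ev; have [eB|] := boolP [disjoint e & B]; last first.
    case/pred0Pn => x /andP[/= xe /BP[g [gE vg xg]]]; right.
    by apply: subset_trans (meet _ _ _ ev gE vg xe xg) (setUS _ (gB _ gE vg)).
  left; apply/subsetP => x xe; rewrite !inE; case: eqP => //= _.
  by rewrite (disjointFr eB xe) (subsetP (triples_sub evE ev)).
pose cod x := [set e in through E v | x \in e].
have codC x (X : {set T}) :
    x != v -> (forall e, e \in cod x -> e \subset X) -> #|cod x| <= #|X| - 2.
  move=> xv cX; apply: (codegree_card (S := X) (v := v) (s := x)); rewrite 1?eq_sym //; last first.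
    by move=> e; rewrite !inE => /andP[/andP[_ ->]].
  apply/subsetP => e ec; rewrite inE cX //=; apply/eqP.
  by apply: (triples_card evE); move: ec; rewrite inE => /andP[].
(* The codegrees of v sum to twice its degree, hence to at least 2n, over
   n - 1 vertices. *)
have [x xS xcod] : exists2 x, x \in S :\ v & 2 < #|cod x|.
  apply/exists_inP; apply: contraT; rewrite negb_exists_in => /forall_inP small.
  have := handshake (through E v) (S :\ v).
  rewrite [X in _ = X](eq_bigr (fun=> 2)); last first.
    move=> e ev; have e3 := triples_card evE ev.
    move: (ev); rewrite inE => /andP[_ ve]; rewrite setIDA (setIidPl (triples_sub evE ev)).
    by move: e3; rewrite (cardsD1 v) ve => -[].
  rewrite sum_nat_const => sum2.
  have : \sum_(x in S :\ v) #|cod x| <= \sum_(x in S :\ v) 2.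
    by apply: leq_sum => x xS; rewrite leqNgt small.
  rewrite sum_nat_const {}sum2 leq_pmul2r //.
  by have := cardsD1 v S; rewrite vS; lia.
have xv : x != v by move: xS; rewrite !inE => /andP[].
have xB : x \notin B.
  apply/negP => /BP[g [gE vg xg]].
  suff : #|cod x| <= 2 by rewrite leqNgt xcod.
  have := codC x (v |: g) xv; rewrite cardsU1 vg (triples_card ES gE); apply.
  by move=> e; rewrite inE => /andP[ev xe]; apply: (meet _ _ x).
have A4 : 3 < #|A|.
  have := codC x (v |: A) xv; rewrite cardsU1 !inE eqxx /= andbF add1n => H.
  suff : #|cod x| <= #|A|.+1 - 2 by move: xcod; clear; lia.
  apply: H => e; rewrite inE => /andP[ev xe]; case: (sides _ ev) => // /subsetP/(_ x xe).
  by rewrite !inE (negPf xv) (negPf xB).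
have B3 : 2 < #|B| by rewrite -(triples_card ES hE); apply/subset_leq_card/gB.
rewrite Scard; apply: leq_ltn_trans (bound_star A4 B3).
have vA : v \notin A by rewrite !inE eqxx andbF.
have EAB : E \subset [set e in through E v | e \subset v |: A] :|:
                     [set e in E | e \subset v |: B].
  apply/subsetP => e eE; rewrite in_setU; apply/orP.
  have [ve|ve] := boolP (v \in e); last first.
    by right; rewrite inE eE (subset_trans (gB e eE ve)) // subsetUr.
  have ev : e \in through E v by rewrite inE eE.
  by case: (sides e ev) => eX; [left; rewrite inE ev | right; rewrite inE eE].
apply: leq_trans (subset_leq_card EAB) (leq_trans (leq_card_setU _ _) (leq_add _ _)).
  have -> : #|A| = #|v |: A|.-1 by rewrite cardsU1 vA.
  apply: (star_card (v := v)); last by move=> e; rewrite !inE => /andP[/andP[]].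
  apply/subsetP => e; rewrite inE => /andP[ev eA].
  by rewrite inE eA (triples_card evE ev).
have -> : #|B|.+1 = #|v |: B| by rewrite cardsU1 vB.
apply: IH; first by rewrite cardsU1 vB Scard; move: A4; clear; lia.
  by apply/subsetP => e; rewrite !inE => /andP[eE ->]; rewrite (triples_card ES eE).
by apply: path_free_sub Pf; apply/subsetP => e; rewrite inE => /andP[].
Qed.

(** Containment in one of the optimal configurations; a family that also
    attains the bound fills it, by counting. *)
Definition extremal E S :=
  (#|S| = 7 /\ exists U, [/\ U \subset S, #|U| = 6 & E \subset triples U]) \/
  (7 < #|S| /\ exists2 v, v \in S & forall e, e \in E -> v \in e).

Lemma triangle_free_bound E S :
  bounded_below #|S| -> E \subset triples S -> path_free E -> triangle_free E ->
  6 < #|S| -> #|E| < bound #|S| \/ extremal E S.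
Proof.
move=> IH ES Pf Tf S7.
have b2 := bin2_mul #|S|.-1; have bb := bound_bin S7.
have bS : bound #|S| = if #|S| == 7 then 20 else 'C(#|S|.-1, 2).
  by rewrite /bound ifN // -ltnNge.
have [/exists_inP[v vS dv]|] := boolP [exists v in S, #|S| <= #|through E v|]; last first.
  rewrite negb_exists_in => /forall_inP low; left.
  have sum3 : #|E| * 3 = \sum_(v in S) #|through E v|.
    rewrite handshake -sum_nat_const; apply: eq_bigr => e eE.
    by rewrite (setIidPl (triples_sub ES eE)) (triples_card ES eE).
  have : \sum_(v in S) #|through E v| <= \sum_(v in S) #|S|.-1.
    by apply: leq_sum => v /low; lia.
  rewrite -sum3 sum_nat_const bS; case: eqP => [->|]; lia || nia.
have dv7 : 6 < #|S| <= #|through E v| by rewrite S7.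
have [/exists_inP[h hE vh]|] := boolP [exists h in E, v \notin h]; last first.
  rewrite negb_exists_in => /forall_inP star.
  have {}star e : e \in E -> v \in e by move/star; rewrite negbK.
  have [S8|S8] := ltnP 7 #|S|; first by right; right; split=> //; exists v.
  have S7' : #|S| = 7 by lia.
  by left; apply: leq_ltn_trans (star_card ES star) _; rewrite S7'.
left.
have [/exists_inP[g gE /andP[vg /exists_inP[e ev eg]]]|] :=
    boolP [exists g in E, (v \notin g) && [exists e in through E v, #|e :&: g| == 1]].
  have := crossing_small ES Pf Tf dv7 gE vg ev (eqP eg).
  by rewrite bS; case: eqP => [->|]; lia || nia.
rewrite negb_exists_in => /forall_inP nc.
apply: (noncrossing_small IH ES Pf dv7 hE vh) => g e gE vg ev.
by move: (nc g gE); rewrite vg negb_exists_in => /forall_inP; apply.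
Qed.

(** * Families containing a triangle *)

(** Let Q be the four vertices of U other than a and b.  Edges with exactly
    one of a, b come in complementary pairs of triples of U; both members of
    a pair would form a path with g in the middle, so at most 6 of them are
    edges.  At most 4 edges contain a and b, and at most 4 - 1 lie in Q as e0
    is missing. *)
Lemma split_bound E S U g a b e0 :
  E \subset triples S -> path_free E -> #|U| = 6 -> g \in E -> a != b ->
  g :&: U = [set a; b] -> e0 \in triples (U :\: [set a; b]) -> e0 \notin E ->
  #|[set e in E | e \subset U]| <= 13.
Proof.
move=> ES Pf U6 gE ab gU e0Q e0E.
pose Q := U :\: [set a; b].
have abU : [set a; b] \subset U by rewrite -gU subsetIr.
have Q4 : #|Q| = 4 by rewrite cardsD (setIidPr abU) U6 cards2 ab.
have aU : a \in U by apply: (subsetP abU); rewrite !inE eqxx.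
have bU : b \in U by apply: (subsetP abU); rewrite !inE eqxx orbT.
have aQ : a \notin Q by rewrite !inE eqxx.
have bQ : b \notin Q by rewrite !inE eqxx orbT.
have memQ x : x \in U -> x != a -> x != b -> x \in Q.
  by move=> xU xa xb; rewrite !inE (negPf xa) (negPf xb).
pose D := [set q : {set T} | q \subset Q & #|q| == 2].
have D6 : #|D| = 6 by rewrite cards_draws Q4.
pose X := [set q in D | a |: q \in E].
pose Y := [set q in D | b |: (Q :\: q) \in E].
have gmem x : x \in U -> (x \in g) = (x == a) || (x == b).
  by move=> xU; have := in_setI x g U; rewrite gU xU andbT !inE.
have gI1 c (q : {set T}) : c \in [set a; b] -> q \subset Q -> g :&: (c |: q) = [set c].
  move=> cab qQ; have cU := subsetP abU _ cab.
  apply/setP => x; rewrite !inE; case: (eqVneq x c) => [->|xc] /=.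
    by rewrite gmem // andbT; move: cab; rewrite !inE.
  apply/negP => /andP[xg xq]; have := subsetP qQ x xq.
  by rewrite !inE => /andP[+ xU]; rewrite -gmem // xg.
have XY : [disjoint X & Y].
  apply/pred0P => q; apply/negP => /andP[/=]; rewrite !inE.
  move=> /andP[/andP[qQ q2] aE] /andP[_ bE].
  have := Pf (a |: q) g (b |: (Q :\: q)) aE gE bE.
  rewrite setIC !gI1 ?subsetDl // ?inE ?eqxx ?orbT // !cards1.
  move=> /(_ erefl erefl); rewrite lt0n cards_eq0 => /negP; apply.
  apply/eqP/setP => x; rewrite !inE; apply/negP => /andP[/orP[/eqP->|xq]].
    by rewrite (negPf ab) aU eqxx /= andbF.
  rewrite xq /= orbF => /eqP xb; move: bQ; rewrite -xb => /negP; apply.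
  exact: (subsetP qQ).
have XYD : #|X| + #|Y| <= 6.
  rewrite -D6 -cardsUI (_ : X :&: Y = set0); last by apply/eqP; rewrite setI_eq0.
  rewrite cards0 addn0; apply/subset_leq_card/subsetP => q.
  by rewrite !inE => /orP[] /andP[].
(* The four parts below are the edges containing a only, b only, neither and
   both. *)
pose Z := triples Q :\ e0.
have Z3 : #|Z| = 3.
  by have := cardsD1 e0 (triples Q); rewrite e0Q card_triples Q4 => -[].
have cover : [set e in E | e \subset U] \subset
   [set a |: q | q in X] :|: [set b |: (Q :\: q) | q in Y] :|: Z
   :|: [set [set t in [:: a; b; z]] | z in Q].
  apply/subsetP => e; rewrite inE => /andP[eE eU].
  have e3 := triples_card ES eE; rewrite !in_setU.
  have Qe : e :\ a :\ b \subset Q.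
    apply/subsetP => x; rewrite !inE => /and3P[xb xa xe].
    by rewrite negb_or xa xb (subsetP eU).
  have [ae|ae] := boolP (a \in e); have [be|be] := boolP (b \in e).
  - have [z u ez] := third_vertex e3 ab ae be.
    apply/orP; right; apply/imsetP; exists z => //.
    move: u; rewrite /= !inE negb_or andbT => /andP[/andP[_ az] bz].
    by rewrite ![z == _]eq_sym negb_or az bz (subsetP eU) // ez !inE eqxx !orbT.
  - suff -> : e \in [set a |: q | q in X] by [].
    apply/imsetP; exists (e :\ a); rewrite ?setD1K // !inE setD1K // eE andbT.
    apply/andP; split; last by move: e3; rewrite (cardsD1 a) ae => -[/eqP].
    apply: subset_trans Qe; apply/subsetP => x; rewrite !inE => /andP[-> xe].
    by rewrite xe !andbT; apply: contraNneq be => <-.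
  - suff -> : e \in [set b |: (Q :\: q) | q in Y] by rewrite orbT.
    have be' : b |: (Q :\: (Q :\: e)) = e.
      apply/setP => x; rewrite in_setU1 in_setD in_setD.
      have [->|xb] /= := eqVneq x b; first by rewrite be.
      case xe: (x \in e); last by case: (x \in Q).
      rewrite memQ ?(subsetP eU) //.
      by apply: contraNneq ae => <-.
    apply/imsetP; exists (Q :\: e) => //; rewrite !inE be' eE andbT.
    rewrite subsetDl /= cardsD Q4; apply/eqP.
    suff -> : Q :&: e = e :\ b by move: e3; rewrite (cardsD1 b) be; case: #|_| => [|[|[|]]].
    apply/setP => x; rewrite in_setI in_setD1 andbC.
    have [->|xb] /= := eqVneq x b; first by rewrite (negPf bQ) andbF.
    case xe: (x \in e) => //=; apply: memQ => //; first exact: (subsetP eU).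
    by apply: contraNneq ae => <-.
  - suff -> : e \in Z by rewrite !orbT.
    rewrite in_setD1 inE e3 eqxx andbT; apply/andP; split.
      by apply: contraNneq e0E => <-.
    apply/subsetP => x xe; apply: memQ; first exact: (subsetP eU).
      by apply: contraNneq ae => <-.
    by apply: contraNneq be => <-.
apply: leq_trans (subset_leq_card cover) _.
apply: leq_trans (leq_card_setU _ _) _; rewrite -[13]/(9 + 4); apply: leq_add.
  apply: leq_trans (leq_card_setU _ _) _; rewrite Z3 -[9]/(6 + 3) leq_add2r.
  apply: leq_trans (leq_card_setU _ _) (leq_trans _ XYD).
  by apply: leq_add; apply: leq_imset_card.
by rewrite -Q4; apply: leq_imset_card.
Qed.

(** The six vertices of a triangle: its edges are x2 x3 y1, x3 x1 y2 and
    x1 x2 y3, so that xi and yi are the vertices for which the indices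
    rotate together, and xi is outside the edge of yi. *)
Definition hexagon (x1 x2 x3 y1 y2 y3 : T) := [:: x1; x2; x3; y1; y2; y3].

Definition triangle_on E x1 x2 x3 y1 y2 y3 :=
  [/\ uniq (hexagon x1 x2 x3 y1 y2 y3), [set t in [:: x2; x3; y1]] \in E,
      [set t in [:: x3; x1; y2]] \in E & [set t in [:: x1; x2; y3]] \in E].

Lemma hexagon_uniq_rot x1 x2 x3 y1 y2 y3 :
  uniq (hexagon x1 x2 x3 y1 y2 y3) -> uniq (hexagon x2 x3 x1 y2 y3 y1).
Proof.
move=> u; rewrite -(perm_uniq (s1 := hexagon x1 x2 x3 y1 y2 y3)) //.
apply/permP => a /=.
by case: (a x1); case: (a x2); case: (a x3); case: (a y1); case: (a y2); case: (a y3).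
Qed.

Lemma triangle_on_rot E x1 x2 x3 y1 y2 y3 :
  triangle_on E x1 x2 x3 y1 y2 y3 -> triangle_on E x2 x3 x1 y2 y3 y1.
Proof. by case=> /hexagon_uniq_rot. Qed.

Lemma hexagon_rot x1 x2 x3 y1 y2 y3 :
  [set t in hexagon x1 x2 x3 y1 y2 y3] = [set t in hexagon x2 x3 x1 y2 y3 y1].
Proof.
apply/setP => t; rewrite !inE.
by case: (t == x1); case: (t == x2); case: (t == x3); case: (t == y1);
  case: (t == y2); case: (t == y3).
Qed.

(** The vertices xi are the pairwise intersections, and the six vertices are
    distinct because inclusion-exclusion gives a union of size 6. *)
Lemma triangle_coords E S e f g :
  E \subset triples S -> e \in E -> f \in E -> g \in E -> triangle e f g ->
  exists x1 x2 x3 y1 y2 y3, triangle_on E x1 x2 x3 y1 y2 y3.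
Proof.
move=> ES eE fE gE [ef1 fg1 eg1 efg0].
have [e3 [f3 g3]] := (triples_card ES eE, (triples_card ES fE, triples_card ES gE)).
have efg x : x \in e -> x \in f -> x \in g -> False.
  by move=> xe xf xg; have := in_set0 x; rewrite -efg0 !inE xe xf xg.
have /card_gt0P[x3] : 0 < #|e :&: f| by rewrite ef1.
rewrite inE => /andP[x3e x3f].
have /card_gt0P[x1] : 0 < #|f :&: g| by rewrite fg1.
rewrite inE => /andP[x1f x1g].
have /card_gt0P[x2] : 0 < #|e :&: g| by rewrite eg1.
rewrite inE => /andP[x2e x2g].
have x23 : x2 != x3 by apply/eqP => eqx; apply: (efg x3) => //; rewrite -eqx.
have x31 : x3 != x1 by apply/eqP => eqx; apply: (efg x1) => //; rewrite -eqx.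
have x12 : x1 != x2 by apply/eqP => eqx; apply: (efg x2) => //; rewrite -eqx.
have [y1 _ ee] := third_vertex e3 x23 x2e x3e.
have [y2 _ ff] := third_vertex f3 x31 x3f x1f.
have [y3 _ gg] := third_vertex g3 x12 x1g x2g.
exists x1, x2, x3, y1, y2, y3; split; rewrite -?ee -?ff -?gg //.
apply/card_uniqP.
have -> : #|hexagon x1 x2 x3 y1 y2 y3| = #|e :|: f :|: g|.
  apply: eq_card => t; rewrite ee ff gg !inE.
  by case: (t == x1); case: (t == x2); case: (t == x3); case: (t == y1);
    case: (t == y2); case: (t == y3).
rewrite !cardsU setIUl cardsU ef1 fg1 eg1 e3 f3 g3.
by rewrite setIACA setIid efg0 cards0.
Qed.

Lemma hexagon_edge_uniq x1 x2 x3 y1 y2 y3 :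
  uniq (hexagon x1 x2 x3 y1 y2 y3) -> uniq [:: x2; x3; y1].
Proof. by move=> u; exact: (mask_uniq u [:: false; true; true; true]). Qed.

(** This turns path-freeness around a triangle into a statement about the six
    booleans telling which vertices of the hexagon belong to g. *)
Lemma card_hexagon_meet x1 x2 x3 y1 y2 y3 g :
  uniq (hexagon x1 x2 x3 y1 y2 y3) ->
  [/\ #|g :&: [set t in hexagon x1 x2 x3 y1 y2 y3]| =
        (x1 \in g) + (x2 \in g) + (x3 \in g) + (y1 \in g) + (y2 \in g) + (y3 \in g),
      #|g :&: [set t in [:: x2; x3; y1]]| = (x2 \in g) + (x3 \in g) + (y1 \in g),
      #|g :&: [set t in [:: x3; x1; y2]]| = (x3 \in g) + (x1 \in g) + (y2 \in g) &
      #|g :&: [set t in [:: x1; x2; y3]]| = (x1 \in g) + (x2 \in g) + (y3 \in g)].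
Proof.
move=> u; have u' := hexagon_uniq_rot u; have u'' := hexagon_uniq_rot u'.
split; rewrite card_setI_seq ?(hexagon_edge_uniq u) ?(hexagon_edge_uniq u')
  ?(hexagon_edge_uniq u'') //= ?addnA ?addn0 //.
Qed.

Lemma loose_edges_meet x1 x2 x3 y1 y2 y3 :
  uniq (hexagon x1 x2 x3 y1 y2 y3) ->
  #|[set t in [:: x2; x3; y1]] :&: [set t in [:: x3; x1; y2]]| = 1.
Proof.
move=> u; have [_ _ -> _] := card_hexagon_meet [set t in [:: x2; x3; y1]] u.
move: u; rewrite /= !inE !negb_or [y2 == x2]eq_sym [y2 == x3]eq_sym [y2 == y1]eq_sym.
rewrite [x3 == x2]eq_sym eqxx => /and5P[/and5P[/negPf-> /negPf-> /negPf-> _ _]].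
by move=> /and4P[_ _ /negPf-> _] /and3P[_ /negPf-> _] /andP[/negPf-> _] _; rewrite orbT.
Qed.

(** If g meets one edge of the triangle in a single vertex, it must meet the
    other two, or else it extends them to a path.  Among the traces of size 1
    or 2, only the pairs xj xk and xi yi pass this test. *)
Lemma trace_pair E x1 x2 x3 y1 y2 y3 g :
  path_free E -> triangle_on E x1 x2 x3 y1 y2 y3 -> g \in E ->
  0 < #|g :&: [set t in hexagon x1 x2 x3 y1 y2 y3]| < 3 ->
  #|g :&: [set t in hexagon x1 x2 x3 y1 y2 y3]| = 2 /\
  [|| (x2 \in g) && (x3 \in g) || (x1 \in g) && (y1 \in g),
      (x3 \in g) && (x1 \in g) || (x2 \in g) && (y2 \in g) |
      (x1 \in g) && (x2 \in g) || (x3 \in g) && (y3 \in g)].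
Proof.
move=> Pf [u e1 e2 e3] gE.
have u' := hexagon_uniq_rot u; have u'' := hexagon_uniq_rot u'.
have m12 := loose_edges_meet u; have m23 := loose_edges_meet u'.
have m31 := loose_edges_meet u''.
have := Pf _ _ _ gE e1 e2 ^~ m12; have := Pf _ _ _ gE e2 e3 ^~ m23.
have := Pf _ _ _ gE e3 e1 ^~ m31.
move: m12 m23 m31; rewrite setIC => m21; rewrite setIC => m32; rewrite setIC => m13.
have := Pf _ _ _ gE e2 e1 ^~ m21; have := Pf _ _ _ gE e3 e2 ^~ m32.
have := Pf _ _ _ gE e1 e3 ^~ m13.
have [-> -> -> ->] := card_hexagon_meet g u; clear.
case: (x1 \in g); case: (x2 \in g); case: (x3 \in g); case: (y1 \in g);
  by case: (y2 \in g); case: (y3 \in g) => //=; do ![move/(_ erefl) => // | move=> _].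
Qed.

(** The edges leaving the hexagon through x2 x3 or through x1 y1, a couple of
    disjoint pairs; the other two couples arise by rotating the indices. *)
Definition attached E x1 x2 x3 y1 y2 y3 : {set {set T}} :=
  [set g in E | (#|g :&: [set t in hexagon x1 x2 x3 y1 y2 y3]| == 2) &&
     ((x2 \in g) && (x3 \in g) || (x1 \in g) && (y1 \in g))].

(** The triangle edges x3 x1 y2 and x1 x2 y3 meet both x2 x3 and x1 y1 in one
    vertex, so each can serve as the middle of a path between an edge on
    x2 x3 and an edge on x1 y1. *)
Lemma attached_meet E x1 x2 x3 y1 y2 y3 g :
  uniq (hexagon x1 x2 x3 y1 y2 y3) ->
  g \in attached E x1 x2 x3 y1 y2 y3 ->
  #|g :&: [set t in [:: x3; x1; y2]]| = 1 /\ #|g :&: [set t in [:: x1; x2; y3]]| = 1.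
Proof.
move=> u; rewrite inE => /and3P[_].
have [-> _ -> ->] := card_hexagon_meet g u; clear.
case: (x1 \in g); case: (x2 \in g); case: (x3 \in g); case: (y1 \in g);
  by case: (y2 \in g); case: (y3 \in g).
Qed.

Lemma meet_pair g U p q :
  #|g :&: U| = 2 -> p != q -> p \in U -> q \in U -> p \in g -> q \in g ->
  g :&: U = [set p; q].
Proof.
move=> gU pq pU qU pg qg; apply/esym/eqP; rewrite eqEcard gU cards2 pq andbT.
by apply/subsetP => t; rewrite !inE => /orP[] /eqP->; rewrite ?pg ?qg.
Qed.

Lemma pair_card F U (W : {set T}) p q :
  (forall g, g \in F -> [/\ #|g| = 3, g :&: U = [set p; q] & g :\: U \subset W]) ->
  p != q -> #|F| <= #|W|.
Proof.
move=> FP pq; apply: leq_trans (_ : #|[set p; q] :|: W| - 2 <= _); last first.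
  by rewrite leq_subLR (leq_trans (leq_card_setU _ _)) // cards2 pq.
apply: (codegree_card (v := p) (s := q)) => // [|g /FP[_ gU _]]; last first.
  have : ([set p; q] \subset g) by rewrite -gU subsetIl.
  by rewrite subUset !sub1set.
apply/subsetP => g /FP[g3 gU gW]; rewrite inE g3 andbT -(setID g U) gU.
exact: setUS.
Qed.

(** An edge on x2 x3 and an edge on x1 y1 have the same outer vertex, by the
    path through x3 x1 y2.  So either one of the two kinds is absent, and the
    edges are counted by their outer vertices, or there is one edge of each
    kind. *)
Lemma attached_card E S (W : {set T}) x1 x2 x3 y1 y2 y3 :
  E \subset triples S -> path_free E -> triangle_on E x1 x2 x3 y1 y2 y3 ->
  (forall g, g \in attached E x1 x2 x3 y1 y2 y3 ->
     g :\: [set t in hexagon x1 x2 x3 y1 y2 y3] \subset W) ->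
  #|attached E x1 x2 x3 y1 y2 y3| <= maxn #|W| 2.
Proof.
move=> ES Pf [u e1 e2 e3]; set U := [set t in _]; set A := attached _ _ _ _ _ _ _ => AW.
pose P := [set g in A | (x2 \in g) && (x3 \in g)].
pose P' := [set g in A | (x1 \in g) && (y1 \in g)].
have AE g : g \in A -> [/\ g \in E, #|g| = 3, #|g :&: U| = 2 & #|g :\: U| = 1].
  rewrite inE => /and3P[gE /eqP gU _]; have g3 := triples_card ES gE.
  by split=> //; have := cardsID U g; rewrite gU g3 => -[].
have [x23 x1y1 PQ0] : [/\ x2 != x3, x1 != y1 & [disjoint [set x2; x3] & [set x1; y1]]].
  move: u; rewrite /= !inE !negb_or => /and5P[/and5P[/negPf n12 /negPf n13 n1 _ _]].
  move=> /and4P[n23 n2 _ _] /and3P[n3 _ _] _ _; split=> //.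
  rewrite -setI_eq0; apply/eqP/setP => t; rewrite !inE; apply/negP.
  case/andP => /orP[] /eqP->; first by rewrite [x2 == x1]eq_sym n12 (negPf n2).
  by rewrite [x3 == x1]eq_sym n13 (negPf n3).
have inU t : t \in hexagon x1 x2 x3 y1 y2 y3 -> t \in U by move=> tH; rewrite /U inE.
have PU g : g \in P -> g :&: U = [set x2; x3].
  rewrite inE => /and3P[/AE[_ _ gU _] g2 g3].
  by apply: meet_pair => //; apply: inU; rewrite !inE eqxx ?orbT.
have PU' g : g \in P' -> g :&: U = [set x1; y1].
  rewrite inE => /and3P[/AE[_ _ gU _] g2 g3].
  by apply: meet_pair => //; apply: inU; rewrite !inE eqxx ?orbT.
have PA g : g \in P -> g \in A by rewrite inE => /andP[].
have PA' g : g \in P' -> g \in A by rewrite inE => /andP[].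
have AP : A \subset P :|: P'.
  apply/subsetP => g gA; rewrite in_setU [g \in P]inE [g \in P']inE gA /=.
  by move: gA; rewrite inE => /and3P[].
have Pcard (X : {set T}) : (forall g, g \in P -> g :\: U \subset X) -> #|P| <= #|X|.
  move=> PX; apply: (pair_card (U := U) _ x23) => g gP.
  by have [_ g3 _ _] := AE g (PA g gP); split; [|exact: PU | exact: PX].
have Pcard' (X : {set T}) : (forall g, g \in P' -> g :\: U \subset X) -> #|P'| <= #|X|.
  move=> PX; apply: (pair_card (U := U) _ x1y1) => g gP.
  by have [_ g3 _ _] := AE g (PA' g gP); split; [|exact: PU' | exact: PX].
have same g h : g \in P -> h \in P' -> g :\: U = h :\: U.
  move=> gP hP; have [gE g3 _ g1] := AE g (PA g gP).
  have [hE h3 _ h1] := AE h (PA' h hP).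
  have [ge _] := attached_meet u (PA g gP).
  have [he _] := attached_meet u (PA' h hP).
  have := Pf _ _ _ gE e2 hE ge; rewrite setIC he => /(_ erefl)/card_gt0P[t].
  rewrite inE => /andP[tg th].
  have tU : t \notin U.
    apply/negP => tU; have : t \in g :&: U by rewrite inE tg.
    rewrite (PU g gP) => /(disjointFr PQ0); rewrite -(PU' h hP) inE th tU //.
  have sing (k : {set T}) : #|k :\: U| = 1 -> t \in k -> k :\: U = [set t].
    by move=> k1 tk; apply/esym/eqP; rewrite eqEcard k1 cards1 sub1set inE tU tk.
  by rewrite (sing g g1 tg) (sing h h1 th).
apply: leq_trans (subset_leq_card AP) (leq_trans (leq_card_setU _ _) _).
have [P0|[g0 g0P]] := set_0Vmem P.
  rewrite P0 cards0 leq_max Pcard' // => g /PA'; exact: AW.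
have [P0|[h0 h0P]] := set_0Vmem P'.
  rewrite P0 cards0 addn0 leq_max Pcard // => g /PA; exact: AW.
rewrite leq_max; apply/orP; right; rewrite -[2]/(1 + 1); apply: leq_add.
  have [_ _ _ <-] := AE h0 (PA' h0 h0P).
  by apply: Pcard => g gP; rewrite (same g h0).
have [_ _ _ <-] := AE g0 (PA g0 g0P).
by apply: Pcard' => h hP; rewrite (same g0 h).
Qed.

(** [split_bound] for the pair in which g meets the hexagon.  The missing
    triple is y1 y2 y3 for the pair x2 x3, because of the path through
    x3 x1 y2, and x3 y2 y3 for the pair x1 y1, because of the path through
    x1 x2 y3. *)
Lemma attached_inner E S x1 x2 x3 y1 y2 y3 g :
  E \subset triples S -> path_free E -> triangle_on E x1 x2 x3 y1 y2 y3 ->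
  g \in attached E x1 x2 x3 y1 y2 y3 ->
  #|[set e in E | e \subset [set t in hexagon x1 x2 x3 y1 y2 y3]]| <= 13.
Proof.
move=> ES Pf [u e1 e2 e3] gA; have [ge2 ge3] := attached_meet u gA.
move: gA; set U := [set t in _]; rewrite inE => /and3P[gE /eqP gU gp].
have U6 : #|U| = 6 by rewrite cardsE; apply/card_uniqP.
have inU t : t \in hexagon x1 x2 x3 y1 y2 y3 -> t \in U by move=> tH; rewrite /U inE.
have claim a b d e0 : a != b -> a \in U -> b \in U -> a \in g -> b \in g ->
    e0 \subset U -> #|e0| = 3 -> a \notin e0 -> b \notin e0 -> d \in E ->
    #|g :&: d| = 1 -> #|e0 :&: d| = 1 -> #|[set e in E | e \subset U]| <= 13.
  move=> ab aU bU ag bg e0U e03 ae0 be0 dE gd e0d.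
  have gab := meet_pair gU ab aU bU ag bg.
  have abe0 : [disjoint e0 & [set a; b]].
    rewrite disjoint_sym -setI_eq0; apply/eqP/setP => t; rewrite !inE.
    by apply/negP => /andP[/orP[]/eqP->]; apply/negP.
  apply: (split_bound ES Pf U6 gE ab gab (e0 := e0)).
    by rewrite inE e03 eqxx andbT subsetD e0U.
  apply/negP => e0E; have := Pf g d e0 gE dE e0E gd; rewrite setIC e0d => /(_ erefl).
  rewrite lt0n cards_eq0 => /negP; apply; rewrite setI_eq0.
  rewrite -(setIidPr e0U) -setI_eq0 setIA gab setI_eq0 disjoint_sym //.
have neqs : [/\ x2 != x3 & x1 != y1].
  by move: u; rewrite /= !inE !negb_or => /and5P[/and5P[_ _ -> _ _] /andP[->]].
have profile (e0 : {set T}) : e0 \subset U -> #|e0| = 3 ->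
    (x1 \in e0) + (x2 \in e0) + (x3 \in e0) + (y1 \in e0) + (y2 \in e0) + (y3 \in e0) = 3.
  by move=> e0U <-; have [<- _ _ _] := card_hexagon_meet e0 u; rewrite (setIidPl e0U).
case: neqs => x23 x1y1; case/orP: gp => /andP[ag bg].
  pose e0 := [set t in [:: y1; y2; y3]].
  have e0U : e0 \subset U by apply/subsetP => t; rewrite !inE => /or3P[] ->; rewrite !orbT.
  have e03 : #|e0| = 3.
    rewrite cardsE; apply/card_uniqP.
    exact: (mask_uniq u [:: false; false; false; true; true; true]).
  have := profile e0 e0U e03; have [_ _ m2 _] := card_hexagon_meet e0 u.
  have [Y1 Y2 Y3] : [/\ y1 \in e0, y2 \in e0 & y3 \in e0] by rewrite !inE !eqxx !orbT.
  move: m2; rewrite Y1 Y2 Y3 => m2 p.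
  have [X1 X2 X3] : [/\ x1 \notin e0, x2 \notin e0 & x3 \notin e0].
    by move: p; case: (x1 \in _); case: (x2 \in _); case: (x3 \in _).
  apply: (claim x2 x3 _ e0 x23 _ _ ag bg e0U e03 X2 X3 e2 ge2).
  - by apply: inU; rewrite !inE eqxx ?orbT.
  - by apply: inU; rewrite !inE eqxx ?orbT.
  by rewrite m2 (negPf X1) (negPf X3).
pose e0 := [set t in [:: x3; y2; y3]].
have e0U : e0 \subset U by apply/subsetP => t; rewrite !inE => /or3P[] ->; rewrite !orbT.
have e03 : #|e0| = 3.
  rewrite cardsE; apply/card_uniqP.
  exact: (mask_uniq u [:: false; false; true; false; true; true]).
have := profile e0 e0U e03; have [_ _ _ m3] := card_hexagon_meet e0 u.
have [Y1 Y2 Y3] : [/\ x3 \in e0, y2 \in e0 & y3 \in e0] by rewrite !inE !eqxx !orbT.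
move: m3; rewrite Y1 Y2 Y3 => m3 p.
have [X1 X2 X3] : [/\ x1 \notin e0, x2 \notin e0 & y1 \notin e0].
  by move: p; case: (x1 \in _); case: (x2 \in _); case: (y1 \in _).
apply: (claim x1 y1 _ e0 x1y1 _ _ ag bg e0U e03 X1 X3 e3 ge3).
- by apply: inU; rewrite !inE eqxx ?orbT.
- by apply: inU; rewrite !inE eqxx ?orbT.
by rewrite m3 (negPf X1) (negPf X2).
Qed.

(** The family splits into the edges EU inside the hexagon U, the edges E2
    attached to it, and the edges E0 disjoint from it.  An edge of E0 cannot
    contain an outer vertex of an attached edge h, since h continues it
    towards an edge of the triangle; so E0 lives outside U and the set W of
    outer vertices. *)
Lemma triangle_on_bound E S x1 x2 x3 y1 y2 y3 :
  bounded_below #|S| -> E \subset triples S -> path_free E ->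
  triangle_on E x1 x2 x3 y1 y2 y3 -> 6 < #|S| ->
  #|E| < bound #|S| \/ extremal E S.
Proof.
move=> IH ES Pf tri S7; have [u e1 e2 e3] := tri.
have tri' := triangle_on_rot tri; have tri'' := triangle_on_rot tri'.
pose U := [set t in hexagon x1 x2 x3 y1 y2 y3].
have U6 : #|U| = 6 by rewrite cardsE; apply/card_uniqP.
have US : U \subset S.
  apply/subsetP => t tU.
  have : t \in [set t in [:: x2; x3; y1]] :|: [set t in [:: x3; x1; y2]]
             :|: [set t in [:: x1; x2; y3]].
    by move: tU; rewrite !inE; do ![case/orP] => /eqP->; rewrite eqxx ?orbT.
  by rewrite !in_setU => /orP[/orP[]|]; apply: subsetP; apply: triples_sub ES _.
pose E2 := [set g in E | #|g :&: U| == 2].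
pose W := (\bigcup_(g in E2) g) :\: U.
pose EU := [set g in E | g \subset U].
pose E0 := [set g in E | g :&: U == set0].
pose A1 := attached E x1 x2 x3 y1 y2 y3.
pose A2 := attached E x2 x3 x1 y2 y3 y1.
pose A3 := attached E x3 x1 x2 y3 y1 y2.
have U2 : U = [set t in hexagon x2 x3 x1 y2 y3 y1] by apply: hexagon_rot.
have U3 : U = [set t in hexagon x3 x1 x2 y3 y1 y2] by rewrite U2; apply: hexagon_rot.
have tr g : g \in E -> 0 < #|g :&: U| < 3 -> g \in E2 /\ [|| g \in A1, g \in A2 | g \in A3].
  move=> gE gU; have [gU2 or3] := trace_pair Pf tri gE gU.
  have {}gU2 : #|g :&: U| == 2 by apply/eqP.
  split; first by rewrite inE gE.
  case/or3P: or3 => pg; apply/or3P; [apply: Or31|apply: Or32|apply: Or33].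
  - by rewrite inE gE gU2.
  - by rewrite inE gE -U2 gU2.
  - by rewrite inE gE -U3 gU2.
have EUE : E \subset EU :|: E2 :|: E0.
  apply/subsetP => g gE; rewrite !in_setU.
  have [gU|gU] := boolP (0 < #|g :&: U| < 3); first by have [-> _] := tr g gE gU; rewrite orbT.
  move: gU; rewrite negb_and -leqNgt leqn0 cards_eq0 => /orP[g0|].
    by rewrite [g \in E0]inE gE g0 orbT.
  rewrite -leqNgt => gU3; rewrite [g \in EU]inE gE /= (_ : g \subset U) //.
  by apply/setIidPl/eqP; rewrite eqEcard subsetIl (triples_card ES gE).
have outer g : g \in E2 -> g :\: U \subset W.
  by move=> gE2; apply: setSD; apply: (bigcup_sup g).
have AE2 g : [|| g \in A1, g \in A2 | g \in A3] -> g \in E2.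
  case/or3P; rewrite inE => /and3P[gE gU _]; rewrite [g \in E2]inE gE //=.
    by rewrite U2.
  by rewrite U3.
have E2A g : g \in E2 -> [|| g \in A1, g \in A2 | g \in A3].
  rewrite inE => /andP[gE /eqP gU]; have [|_ //] := tr g gE _.
  by rewrite gU.
have E2card : #|E2| <= 3 * maxn #|W| 2.
  have E2s : E2 \subset A1 :|: (A2 :|: A3).
    by apply/subsetP => g /E2A; rewrite !in_setU.
  apply: leq_trans (subset_leq_card E2s) _; rewrite mulSn mul2n -addnn.
  apply: leq_trans (leq_card_setU _ _) (leq_add _ (leq_trans (leq_card_setU _ _) (leq_add _ _))).
  - by apply: (attached_card ES Pf tri) => g gA; apply/outer/AE2; rewrite gA.
  - apply: (attached_card ES Pf tri') => g gA; rewrite -U2.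
    by apply/outer/AE2; rewrite gA orbT.
  - apply: (attached_card ES Pf tri'') => g gA; rewrite -U3.
    by apply/outer/AE2; rewrite gA !orbT.
have meet_edge h : h \in E2 -> exists d, [/\ d \in E, d \subset U & #|h :&: d| = 1].
  have e1U : [set t in [:: x2; x3; y1]] \subset U.
    by apply/subsetP => t; rewrite !inE => /or3P[] ->; rewrite ?orbT.
  have e2U : [set t in [:: x3; x1; y2]] \subset U.
    by apply/subsetP => t; rewrite !inE => /or3P[] ->; rewrite ?orbT.
  have e3U : [set t in [:: x1; x2; y3]] \subset U.
    by apply/subsetP => t; rewrite !inE => /or3P[] ->; rewrite ?orbT.
  have u' := hexagon_uniq_rot u; have u'' := hexagon_uniq_rot u'.
  case/E2A/or3P => [/(attached_meet u)|/(attached_meet u')|/(attached_meet u'')] [hd _].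
  - by exists [set t in [:: x3; x1; y2]].
  - by exists [set t in [:: x1; x2; y3]].
  - by exists [set t in [:: x2; x3; y1]].
have E0W g : g \in E0 -> [disjoint g & W].
  rewrite inE => /andP[gE /eqP gU]; rewrite -setI_eq0; apply/eqP/setP => t.
  rewrite in_setI in_setD in_set0; apply/negP => /and3P[tg tU /bigcupP[h hE2 th]].
  have [d [dE dU hd]] := meet_edge h hE2.
  move: hE2; rewrite inE => /andP[hE /eqP hU].
  have /cards1P[w hw] : #|h :\: U| == 1.
    by have := cardsID U h; rewrite hU (triples_card ES hE) => -[/eqP].
  have gh : #|g :&: h| = 1.
    apply/eqP/cards1P; exists w; rewrite -hw; apply/setP => z; rewrite in_setI in_setD.
    have [zh|] := boolP (z \in h); last by rewrite !andbF.
    rewrite !andbT; have [zU|zU] := boolP (z \in U).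
      by apply/negbTE/negP => zg; have := in_set0 z; rewrite -gU in_setI zg zU.
    have eqw y : y \in h -> y \notin U -> y = w.
      by move=> yh yU; apply/set1P; rewrite -hw in_setD yh yU.
    by rewrite (eqw z) // -(eqw t).
  have := Pf g h d gE hE dE gh hd; rewrite lt0n cards_eq0 => /negP; apply.
  by rewrite -subset0 -gU setIS.
have WS : W \subset S :\: U.
  apply: setSD; apply/bigcupsP => g; rewrite inE => /andP[gE _].
  exact: triples_sub ES gE.
have SU : #|S| = #|W| + #|S :\: U :\: W| + 6.
  by rewrite -(cardsID U S) (setIidPr US) U6 -(cardsID W (S :\: U)) (setIidPr WS) addnC.
have E0card : #|E0| <= bound #|S :\: U :\: W|.
  apply: IH; first by rewrite SU; clear; lia.
    apply/subsetP => g gE0; move: (gE0); rewrite [g \in E0]inE => /andP[gE gU].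
    rewrite inE (triples_card ES gE) eqxx andbT !subsetD (triples_sub ES gE) /=.
    by rewrite E0W // -setI_eq0 gU.
  by apply: path_free_sub Pf; apply/subsetP => g; rewrite inE => /andP[].
have EUcard : #|EU| <= 20.
  rewrite -[20]/'C(6, 3) -U6 -card_triples; apply/subset_leq_card/subsetP => g.
  by rewrite !inE => /andP[gE ->]; rewrite (triples_card ES gE).
have Ecard : #|E| <= #|EU| + #|E2| + #|E0|.
  apply: leq_trans (subset_leq_card EUE) (leq_trans (leq_card_setU _ _) _).
  by rewrite leq_add2r leq_card_setU.
have [E20|[g gE2]] := set_0Vmem E2; last first.
  left; have EU13 : #|EU| <= 13.
    case/or3P: (E2A g gE2) => [/(attached_inner ES Pf tri)|
      /(attached_inner ES Pf tri')|/(attached_inner ES Pf tri'')] //.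
      by rewrite -U2.
    by rewrite -U3.
  have W0 : 0 < #|W|.
    apply: leq_trans (subset_leq_card (outer g gE2)).
    move: gE2; rewrite inE => /andP[gE /eqP gU].
    by have := cardsID U g; rewrite gU (triples_card ES gE); case: #|g :\: U|.
  have := bound_attached #|S :\: U :\: W| W0.
  rewrite [_ + 6 + _]addnAC [_ + #|W|]addnC -SU; apply: leq_ltn_trans.
  by apply: leq_trans Ecard _; rewrite !leq_add.
have W0 : W = set0.
  by rewrite /W E20 big_set0 set0D.
move: SU Ecard E0card; rewrite W0 setD0 E20 !cards0 addn0 add0n => SU Ecard E0card.
have [SU1|SU1] := leqP #|S :\: U| 1; last first.
  left; rewrite SU; apply: leq_ltn_trans (bound_block SU1).
  by apply: leq_trans Ecard _; apply: leq_add.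
right; left; split; first by move: SU SU1 S7; clear; lia.
exists U; split=> //; apply/subsetP => g gE; rewrite inE (triples_card ES gE) eqxx andbT.
have := subsetP EUE g gE; rewrite E20 setU0 => /setUP[]; first by rewrite inE => /andP[].
rewrite inE => /andP[_ gU]; have : g \subset S :\: U.
  by rewrite subsetD (triples_sub ES gE) -setI_eq0.
by move/subset_leq_card; rewrite (triples_card ES gE) => /leq_trans/(_ SU1).
Qed.

(** * The extremal families *)

Lemma path_free_extremal E S :
  E \subset triples S -> path_free E -> 6 < #|S| -> #|E| < bound #|S| \/ extremal E S.
Proof.
have [n Sn] := ubnP #|S|; elim: n => // n IHn in E S Sn * => ES Pf S7.
have IH : bounded_below #|S|.
  move=> S' E' S'S E'S' Pf'; have [S'6|S'7] := leqP #|S'| 6.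
    by rewrite /bound S'6 -card_triples subset_leq_card.
  have S'n : #|S'| < n by apply: leq_trans S'S _.
  have [/ltnW //|] := IHn E' S' S'n E'S' Pf' S'7.
  case=> [[S'eq [U [_ U6 E'U]]]|[S'8 [v vS' star]]].
    by rewrite S'eq (leq_trans (subset_leq_card E'U)) // card_triples U6.
  by apply: leq_trans (star_card E'S' star) (bound_bin S'7).
have [/exists_inP[e eE /exists_inP[f fE /exists_inP[g gE]]]|] :=
  boolP [exists e in E, exists f in E, exists g in E,
    [&& #|e :&: f| == 1, #|f :&: g| == 1, #|e :&: g| == 1 & e :&: f :&: g == set0]].
  case/and4P => /eqP ef /eqP fg /eqP eg /eqP efg.
  have efgT : triangle e f g by [].
  have [x1 [x2 [x3 [y1 [y2 [y3 tri]]]]]] := triangle_coords ES eE fE gE efgT.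
  exact: triangle_on_bound tri S7.
move=> noT; apply: triangle_free_bound => // e f g eE fE gE [ef fg eg efg].
case/negP: noT; apply/exists_inP; exists e => //; apply/exists_inP; exists f => //.
by apply/exists_inP; exists g; rewrite ?ef ?fg ?eg ?efg ?eqxx.
Qed.

Lemma path_free_bound E S : E \subset triples S -> path_free E -> #|E| <= bound #|S|.
Proof.
move=> ES Pf; have [S6|S7] := leqP #|S| 6.
  by rewrite /bound S6 -card_triples subset_leq_card.
have [/ltnW //|] := path_free_extremal ES Pf S7.
case=> [[Seq [U [_ U6 EU]]]|[S8 [v vS star]]].
  by rewrite Seq (leq_trans (subset_leq_card EU)) // card_triples U6.
by apply: leq_trans (star_card ES star) (bound_bin S7).
Qed.

End Triples.

Lemma card_path (T : finType) (e f g : {set T}) :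
  #|e| = 3 -> #|f| = 3 -> #|g| = 3 -> #|e :&: f| = 1 -> #|f :&: g| = 1 ->
  e :&: g = set0 -> #|e :|: f :|: g| = 7.
Proof.
move=> e3 f3 g3 ef fg eg.
by rewrite !cardsU setIUl eg set0U fg ef e3 f3 g3.
Qed.

(** A path has seven vertices. *)
Lemma path_free_small (T : finType) (E : {set {set T}}) (U : {set T}) :
  E \subset triples U -> #|U| <= 6 -> path_free E.
Proof.
move=> EU U6 e f g eE fE gE ef fg; rewrite lt0n cards_eq0; apply/negP => /eqP eg.
have := card_path (triples_card EU eE) (triples_card EU fE) (triples_card EU gE) ef fg eg.
apply/eqP; rewrite neq_ltn ltnS (leq_trans _ U6) // subset_leq_card //.
by rewrite !subUset !(triples_sub EU).
Qed.

(** * From families of triples to 3-graphs *)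

Lemma edges_triples (V : finType) (H : graph3 V) : edges H \subset triples [set: V].
Proof.
apply/subsetP => e eH; rewrite inE subsetT; exact: (forall_inP (edges_card3 H)).
Qed.

Lemma path_free_imset (V W : finType) (f : V -> W) (E : {set {set V}}) :
  injective f -> path_free E -> path_free [set f @: (e : {set V}) | e in E].
Proof.
move=> injf Pf _ _ _ /imsetP[e eE ->] /imsetP[g gE ->] /imsetP[h hE ->].
rewrite -!imsetI ?card_imset; try by move=> *; apply: injf.
exact: Pf.
Qed.

(** A copy of P33 is recovered from three edges e, f, g by listing the seven
    vertices of their union along the path: two of e, then the common one of
    e and f, the middle one, the common one of f and g, then two of g. *)
Lemma free_path_free (V : finType) (H : graph3 V) :
  free P33 H <-> path_free (edges H).
Proof.
have HT := edges_triples H; split=> [/negP noP e f g eH fH gH ef fg|Pf].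
  rewrite lt0n cards_eq0; apply/negP => /eqP eg; apply: noP.
  have [e3 f3] := (triples_card HT eH, triples_card HT fH).
  have g3 := triples_card HT gH.
  have /cards1P[c efc] : #|e :&: f| == 1 by rewrite ef.
  have /cards1P[d fgd] : #|f :&: g| == 1 by rewrite fg.
  have [ce cf] : c \in e /\ c \in f by apply/setIP; rewrite efc inE.
  have [df dg] : d \in f /\ d \in g by apply/setIP; rewrite fgd inE.
  have cd : c != d.
    by apply/eqP => cd; have := in_set0 c; rewrite -eg inE ce cd dg.
  have [m um fm] := third_vertex f3 cd cf df.
  have /cards2P[a [b [ab eab]]] : #|e :\ c| == 2.
    by move: e3; rewrite (cardsD1 c) ce => -[/eqP].
  have /cards2P[p [q [pq gpq]]] : #|g :\ d| == 2.
    by move: g3; rewrite (cardsD1 d) dg => -[/eqP].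
  have ee : e = c |: [set a; b] by rewrite -eab setD1K.
  have gg : g = d |: [set p; q] by rewrite -gpq setD1K.
  pose s := [:: a; b; c; m; d; p; q].
  have us : uniq s.
    apply/card_uniqP; rewrite /= -(card_path e3 f3 g3 ef fg eg).
    apply: eq_card => t; rewrite ee fm gg !inE.
    by case: (t == a); case: (t == b); case: (t == c); case: (t == m);
       case: (t == d); case: (t == p); case: (t == q).
  have inj : injective (fun i : 'I_7 => nth a s i).
    by move=> i j /eqP; rewrite (@nth_uniq _ a s i j (ltn_ord i) (ltn_ord j) us) => /eqP/val_inj.
  apply/existsP; exists [ffun i : 'I_7 => nth a s i]; apply/andP; split.
    by apply/injectiveP => i j; rewrite !ffunE => /inj.
  apply/forall_inP => _ /imsetP[i _ ->].
  have im : forall k, k \in edges H -> (forall x, x \in path_edge i -> nth a s x \in k) ->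
      [ffun i0 : 'I_7 => nth a s i0] @: path_edge i \in edges H.
    move=> k kH sub; suff -> : [ffun i0 : 'I_7 => nth a s i0] @: path_edge i = k by [].
    rewrite (eq_imset _ (ffunE _)); apply/eqP; rewrite eqEcard card_imset //.
    have -> : #|path_edge i| = 3 by have := path_edge_meet i i; rewrite setIid eqxx.
    rewrite (triples_card HT kH) andbT.
    by apply/subsetP => _ /imsetP[x xi ->]; apply: sub.
  case: i im => [[|[|[|//]]] lti] im.
  - apply: (im e) => // -[[|[|[|[|[|[|[|//]]]]]]] ltx]; rewrite inE //= ee !inE eqxx ?orbT //.
  - apply: (im f) => // -[[|[|[|[|[|[|[|//]]]]]]] ltx]; rewrite inE //= fm !inE eqxx ?orbT //.
  - apply: (im g) => // -[[|[|[|[|[|[|[|//]]]]]]] ltx]; rewrite inE //= gg !inE eqxx ?orbT //.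
apply/negP => /existsP[f /andP[/injectiveP injf /forall_inP fH]].
pose e i := f @: path_edge i.
have eH i : e i \in edges H by apply/fH/imset_f.
have meet i j : #|e i :&: e j| =
    if i == j then 3 else if (j == i.+1 :> nat) || (i == j.+1 :> nat) then 1 else 0.
  by rewrite -imsetI ?card_imset ?path_edge_meet //; move=> *; apply: injf.
pose i0 : 'I_3 := @Ordinal 3 0 isT.
pose i1 : 'I_3 := @Ordinal 3 1 isT.
pose i2 : 'I_3 := @Ordinal 3 2 isT.
have := Pf (e i0) (e i1) (e i2) (eH _) (eH _) (eH _).
by rewrite !meet => /(_ erefl erefl).
Qed.

(** Enumerate both types with A and B first, and match the positions.  The
    element w0 only serves as the default value of the enumeration. *)
Lemma exists_bij (V W : finType) (w0 : W) (A : {set V}) (B : {set W}) :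
  #|V| = #|W| -> #|A| = #|B| -> exists2 f : V -> W, bijective f & f @: A = B.
Proof.
move=> VW AB; pose s := enum A ++ enum (~: A); pose t := enum B ++ enum (~: B).
have us : uniq s.
  by rewrite cat_uniq !enum_uniq andbT -all_predC; apply/allP => x /=; rewrite !mem_enum inE.
have ut : uniq t.
  by rewrite cat_uniq !enum_uniq andbT -all_predC; apply/allP => x /=; rewrite !mem_enum inE.
have ms x : x \in s by rewrite mem_cat !mem_enum inE orbN.
have sz : size s = size t by rewrite !size_cat -!cardE !cardsC.
have ix x : index x s < size t by rewrite -sz index_mem.
pose f x := nth w0 t (index x s).
have injf : injective f.
  move=> x y /eqP; rewrite nth_uniq ?ix // => /eqP eq_ix.
  by rewrite -(nth_index x (ms x)) eq_ix nth_index.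
exists f; first by apply: inj_card_bij => //; rewrite VW.
apply/eqP; rewrite eqEcard card_imset // AB leqnn andbT.
apply/subsetP => _ /imsetP[x xA ->].
have xB : index x (enum A) < size (enum B) by rewrite -cardE -AB cardE index_mem mem_enum.
by rewrite /f /s /t index_cat mem_enum xA nth_cat xB -mem_enum mem_nth.
Qed.

Lemma isomorphic_by (V W : finType) (H : graph3 V) (K : graph3 W) (f : V -> W) :
  bijective f -> (forall e : {set V}, (f @: e \in edges K) = (e \in edges H)) ->
  isomorphic H K.
Proof.
move=> bijf HK; exists f => //; apply/setP => e.
have ef : e = f @: (f @^-1: e).
  case: bijf => g fK gK; apply/setP => y; apply/idP/imsetP => [ye|[x + ->]].
    by exists (g y); rewrite ?inE gK.
  by rewrite inE.
rewrite {1}ef HK; apply/idP/imsetP => [eH|[d dH ->]]; first by exists (f @^-1: e).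
rewrite (_ : f @^-1: _ = d) //; apply/setP => x.
by rewrite inE mem_imset //; apply: bij_inj.
Qed.

Lemma isomorphic_triples (V W : finType) (H : graph3 V) (K : graph3 W) (U : {set V})
    (U' : {set W}) :
  0 < #|W| -> #|V| = #|W| -> #|U| = #|U'| -> edges H = triples U -> edges K = triples U' ->
  isomorphic H K.
Proof.
move=> /card_gt0P[w0 _] VW UU' HU KU.
have [f bijf fU] := exists_bij w0 VW UU'; have injf := bij_inj bijf.
apply: (isomorphic_by bijf) => e; rewrite HU KU !inE -fU card_imset //.
congr andb; apply/idP/idP => [/subsetP sub|]; last exact: imsetS.
by apply/subsetP => x xe; rewrite -(mem_imset U x injf) sub // imset_f.
Qed.

Lemma isomorphic_star (V W : finType) (H : graph3 V) (K : graph3 W) (v : V) (w : W) :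
  #|V| = #|W| -> edges H = [set e : {set V} | (#|e| == 3) && (v \in e)] ->
  edges K = [set e : {set W} | (#|e| == 3) && (w \in e)] -> isomorphic H K.
Proof.
move=> VW HU KU; have [|f bijf] := exists_bij w (A := [set v]) (B := [set w]) VW.
  by rewrite !cards1.
rewrite imset_set1 => /set1_inj fv; have injf := bij_inj bijf.
by apply: (isomorphic_by bijf) => e; rewrite HU KU !inE -fv card_imset // mem_imset.
Qed.

Lemma card_star (V : finType) (v : V) :
  #|[set e : {set V} | (#|e| == 3) && (v \in e)]| = 'C(#|V|.-1, 2).
Proof.
apply/eqP; rewrite eqn_leq; apply/andP; split.
  rewrite -cardsT; apply: (star_card (v := v)) => [|e]; last by rewrite inE => /andP[].
  by apply/subsetP => e; rewrite !inE subsetT => /andP[].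
have -> : #|V|.-1 = #|[set: V] :\ v| by rewrite -cardsT (cardsD1 v [set: V]) inE.
rewrite -cards_draws -(card_in_imset (f := fun q => v |: q)); last first.
  move=> q r; rewrite !inE !subsetD1 => /andP[/andP[_ vq] _] /andP[/andP[_ vr] _] eq_qr.
  by rewrite -(setU1K vq) eq_qr setU1K.
apply: subset_leq_card; apply/subsetP => _ /imsetP[q + ->].
by rewrite !inE subsetD1 eqxx andbT => /andP[/andP[_ vq] /eqP q2]; rewrite cardsU1 vq q2.
Qed.

(** [ex3] ranges over the vertex type of ordinals only, so the graph is first
    carried over along a bijection. *)
Lemma free_card_ex3 (V : finType) n (H : graph3 V) :
  0 < n -> #|V| = n -> free P33 H -> #|edges H| <= ex3 n P33.
Proof.
case: n => // n _ Vn /free_path_free Pf.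
have VI : #|V| = #|'I_n.+1| by rewrite card_ord.
have [f bijf _] := exists_bij ord0 VI (A := set0) (B := set0) (etrans (cards0 _) (esym (cards0 _))).
have injf := bij_inj bijf.
have fH3 : [forall e in [set f @: (e : {set V}) | e in edges H], #|e| == 3].
  apply/forall_inP => _ /imsetP[e eH ->].
  by rewrite card_imset // (triples_card (edges_triples H) eH).
rewrite -(card_imset (edges H) (imset_inj injf)).
apply: (leq_bigmax_cond (Graph3 fH3)); apply/free_path_free.
exact: path_free_imset.
Qed.

(** All three parts of the theorem have this shape, [bound n] being the
    extremal number: the upper bound is [path_free_bound]. *)
Lemma Ex3_uniqueI (W : finType) n (K : graph3 W) :
  0 < n -> #|W| = n -> path_free (edges K) -> #|edges K| = bound n ->
  (forall (V : finType) (H : graph3 V), #|V| = n -> path_free (edges H) ->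
     #|edges H| = bound n -> isomorphic H K) ->
  ex3 n P33 = bound n /\ Ex3_unique n P33 K.
Proof.
move=> n0 Wn /free_path_free Pf Kn uniqK.
have exn : ex3 n P33 = bound n.
  apply/eqP; rewrite eqn_leq -{2}Kn free_card_ex3 // andbT.
  apply/bigmax_leqP => H /free_path_free PH.
  by have := path_free_bound (edges_triples H) PH; rewrite cardsT card_ord.
split=> //; split; first by split=> //; rewrite Kn.
by move=> V H [Vn /free_path_free PH Hn]; apply: uniqK; rewrite // Hn.
Qed.

Theorem theorem1 (n : nat) (n_gt0 : 0 < n) :
  [/\ n <= 6 ->
        ex3 n P33 = 'C(n, 3) /\ Ex3_unique n P33 (complete3 n),
      n = 7 ->
        ex3 n P33 = 20 /\ Ex3_unique n P33 (dunion (complete3 6) (complete3 1))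
    & 8 <= n ->
        ex3 n P33 = 'C(n.-1, 2) /\ Ex3_unique n P33 (star3 n_gt0)].
Proof.
split=> [n6|n7|n8].
- have bn : bound n = 'C(n, 3) by rewrite /bound n6.
  have Kn : edges (complete3 n) = triples [set: 'I_n].
    by apply/setP => e; rewrite !inE subsetT.
  rewrite -bn; apply: Ex3_uniqueI; rewrite ?card_ord //.
  + by apply: (path_free_small (edges_triples _)); rewrite cardsT card_ord.
  + by rewrite Kn card_triples cardsT card_ord.
  move=> V H Vn _ Hn; apply: (isomorphic_triples (U := setT) _ _ _ _ Kn).
  + by rewrite card_ord.
  + by rewrite card_ord.
  + by rewrite !cardsT card_ord.
  by apply/eqP; rewrite eqEcard edges_triples Hn bn card_triples cardsT Vn leqnn.
- subst n; set K := dunion _ _; pose U : {set 'I_6 + 'I_1} := inl @: [set: 'I_6].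
  have inl_inj : injective (@inl 'I_6 'I_1) by move=> x y [].
  have U6 : #|U| = 6 by rewrite card_imset // cardsT card_ord.
  have T20 : #|triples U| = 20 by rewrite card_triples U6.
  have Kn : edges K = triples U.
    apply/eqP; rewrite eqEsubset; apply/andP; split; apply/subsetP => e.
      rewrite inE => eK; rewrite inE (triples_card (edges_triples K)) ?inE // andbT.
      case/orP: eK => /imsetP[d]; rewrite inE => /eqP d3 ->; first exact: imsetS.
      by have := max_card d; rewrite d3 card_ord.
    rewrite inE => /andP[/subsetP eU /eqP e3]; rewrite inE; apply/orP; left.
    have ed : e = inl @: (inl @^-1: e).
      apply/setP => x; apply/idP/imsetP => [xe|[y + ->]]; last by rewrite inE.
      by have /imsetP[y _ xy] := eU x xe; exists y; rewrite // inE -xy.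
    apply/imsetP; exists (inl @^-1: e); last exact: ed.
    by rewrite inE -(card_imset _ inl_inj) -ed e3.
  apply: (@Ex3_uniqueI _ 7) => //.
  + by rewrite card_sum !card_ord.
  + by apply: (@path_free_small _ _ U); rewrite ?Kn ?U6.
  + by rewrite Kn T20.
  move=> V H Vn PH Hn; have HT := edges_triples H.
  have V7 : 6 < #|[set: V]| by rewrite cardsT Vn.
  have := path_free_extremal HT PH V7; rewrite /extremal cardsT Vn Hn ltnn.
  case=> // -[[_ [X [_ X6 HX]]]|[]] //.
  apply: (isomorphic_triples (U := X) _ _ _ _ Kn).
  + by rewrite card_sum !card_ord.
  + by rewrite card_sum !card_ord.
  + by rewrite X6 U6.
  by apply/eqP; rewrite eqEcard HX Hn card_triples X6.
have bn : bound n = 'C(n.-1, 2).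
  by rewrite /bound; case: n n8 {n_gt0} => [|[|[|[|[|[|[|[|n]]]]]]]].
have Kn : #|edges (star3 n_gt0)| = 'C(n.-1, 2) by rewrite card_star card_ord.
rewrite -bn; apply: Ex3_uniqueI; rewrite ?card_ord ?bn //.
  move=> e f g; rewrite !inE => /andP[_ ve] _ /andP[_ vg] _ _.
  by apply/card_gt0P; exists (Ordinal n_gt0); rewrite inE ve.
move=> V H Vn PH Hn; have HT := edges_triples H.
have V7 : 6 < #|[set: V]| by rewrite cardsT Vn ltnW.
have := path_free_extremal HT PH V7; rewrite /extremal cardsT Vn Hn bn ltnn.
case=> // -[[n7]|[_ [v _ star]]]; first by rewrite n7 in n8.
apply: (isomorphic_star (v := v) (w := Ordinal n_gt0)) => //; first by rewrite card_ord.
apply/eqP; rewrite eqEcard card_star Vn Hn leqnn andbT.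
by apply/subsetP => e eH; rewrite inE (star _ eH) (triples_card HT eH).
Qed.
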